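(* Assume $f\in S([0,1))$ and that the noise variables $\xi_i^n\sim N(0,\sigma^2)$, $i=1,\dots,n$, are i.i.d. for every $n$, in the regression model described in the context. Let $\delta>0$ and let $\hat\sigma$ be a consistent estimate of $\sigma$. Assume $\hat\gamma_n$ is chosen according to the MR-criterion, that is, $\hat\gamma_n$ is the maximal value such that the corresponding reconstruction $\hat f_n^{MR}\in\iota^n(\arg\min H_{\hat\gamma_n}(\cdot,Y^n))$ satisfies $$\frac{1}{\sqrt{\#I}}\left|\sum_{i\in I}\left(Y_i^n-\hat f_n^{MR}(x_i^n)\right)\right|\le(1+\delta)\,\hat\sigma\,\sqrt{2\log n}$$ for all connected $I\subset\{1,\dots,n\}$ (i.e. all nonempty sets of consecutive indices). Moreover, assume that $(\gamma_n)_{n\in\mathbb{N}}$ is a (possibly random) sequence satisfying $\gamma_n\to0$ and $\gamma_n n/\log n\to\infty$ $\mathbb{P}$-almost surely, and let $\hat f_n\in\iota^n(\arg\min H_{\gamma_n}(\cdot,Y^n))$ be the corresponding reconstruction. Then $$\mathbb{P}\left(\hat f_n^{MR}=\hat f_n\right)\longrightarrow1\quad\text{as }n\to\infty.$$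
   Context: Regression model: for each $n$, with $x_i^n=i/n$ ($0\le i\le n$), one observes $Y_i^n=\overline f_i^n+\xi_i^n$, $i=1,\dots,n$, where $\overline f_i^n=(x_i^n-x_{i-1}^n)^{-1}\int_{x_{i-1}^n}^{x_i^n}f(u)\,du$; $Y^n=(Y_1^n,\dots,Y_n^n)$. All random variables are defined on a common probability space with measure $\mathbb{P}$. Potts functional: for $u,Y\in\mathbb{R}^n$, $H_\gamma(u,Y)=\frac1n\sum_{i=1}^n(u_i-Y_i)^2+\gamma\cdot\#\{i:1\le i\le n-1,\ u_i\ne u_{i+1}\}$. The set of minimizers over $u\in\mathbb{R}^n$ is denoted $\arg\min H_\gamma(\cdot,Y)$. Embedding: $\iota^n((u_1,\dots,u_n))=\sum_{i=1}^nu_i\mathbf{1}_{[(i-1)/n,i/n)}$ for $(u_1,\dots,u_n)\in\mathbb{R}^n$; the value of such a step function at $1$ is taken to be its left limit. $S([0,1))$ is the space of right-continuous step functions $\sum_{i=1}^m\alpha_i\mathbf{1}_{[t_i,t_{i+1})}$, $\alpha_i\in\mathbb{R}$, $0=t_1<\dots<t_{m+1}=1$, $m\in\mathbb{N}$. An estimate $\hat\sigma=\hat\sigma_n$ of $\sigma$ is consistent if $\hat\sigma_n\to\sigma$ in probability. *)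

(* Defs.v *)
(* MathComp-Analysis. *)
From HB Require Import structures.
From mathcomp Require Import all_boot all_order all_algebra.
From mathcomp Require Import all_classical all_reals all_analysis.
Import Order.TTheory GRing.Theory Num.Theory.
Import numFieldNormedType.Exports.

Set Implicit Arguments.
Unset Strict Implicit.
Unset Printing Implicit Defensive.

Local Open Scope classical_set_scope.
Local Open Scope ring_scope.

(* Indices are shifted by one throughout: the ordinal i : 'I_n stands for the
   one-based index i + 1. *)

Definition design {R : realType} (n i : nat) : R := i%:R / n%:R.

(* Values of f outside [0, 1[ are irrelevant. *)
Definition right_cont_step {R : realType} (f : R -> R) : Prop :=
  exists (m : nat) (alpha t : nat -> R),
    [/\ t 0%N = 0, t m = 1,
        (forall i, (i < m)%N -> t i < t i.+1) &
        forall x : R, 0 <= x < 1 ->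
          f x = \sum_(i < m) alpha i * \1_(`[t i, t i.+1[) x].

Definition cell_mean {R : realType} (f : R -> R) (n : nat) (i : 'I_n) : R :=
  (design n i.+1 - design n i)^-1 *
  (\int[@lebesgue_measure R]_(u in `[design n i, design n i.+1]) f u)%R.

Definition njumps {R : realType} {n : nat} (u : 'rV[R]_n) : nat :=
  #|[pred p : 'I_n * 'I_n | (p.2 == p.1.+1 :> nat) && (u 0 p.1 != u 0 p.2)]|.

(* The penalty ranges over the extended reals: with gamma = +oo (and
   +oo * 0 = 0) exactly the constant vectors have finite energy, so that
   argmin_potts +oo Y consists of the constant vector of the mean of Y. *)
Definition potts {R : realType} {n : nat} (gamma : \bar R) (u Y : 'rV[R]_n) :
    \bar R :=
  ((n%:R^-1 * \sum_(i < n) (u 0 i - Y 0 i) ^+ 2)%:E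
   + gamma * (njumps u)%:R%:E)%E.

Definition argmin_potts {R : realType} {n : nat} (gamma : \bar R)
    (Y : 'rV[R]_n) : set 'rV[R]_n :=
  [set u | forall v, (potts gamma u Y <= potts gamma v Y)%E].

Definition iota_step {R : realType} {n : nat} (u : 'rV[R]_n) (x : R) : R :=
  \sum_(i < n) u 0 i * \1_(`[design n i, design n i.+1[) x.

Definition iota_embed {R : realType} {n : nat} (u : 'rV[R]_n) (x : R) : R :=
  if x == 1 then lim (iota_step u y @[y --> 1^'-]) else iota_step u x.

Definition connected_idx {n : nat} (I : {set 'I_n}) : Prop :=
  I != finset.set0 /\
  forall i j k : 'I_n, i \in I -> k \in I -> (i <= j <= k)%N -> j \in I.

(* s is the estimate of the noise standard deviation.  Since iota_embed u is
   right-continuous, its value at design n i.+1 is the entry of u of index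
   i.+1, or the last entry of u if i is the last index. *)
Definition MR_bound {R : realType} {n : nat} (delta s : R)
    (Y u : 'rV[R]_n) : Prop :=
  forall I : {set 'I_n}, connected_idx I ->
    (Num.sqrt #|I|%:R)^-1 *
      `| \sum_(i in I) (Y 0 i - iota_embed u (design n i.+1)) |
    <= (1 + delta) * s * Num.sqrt (2 * ln n%:R).

Definition MR_admissible {R : realType} {n : nat} (delta s : R)
    (Y : 'rV[R]_n) (gamma : \bar R) (u : 'rV[R]_n) : Prop :=
  [/\ (0 <= gamma)%E, argmin_potts gamma Y u & MR_bound delta s Y u].

(* The maximum is taken in [0, +oo]: when the constant fit satisfies the bound
   all large penalties are admissible and the maximal one is +oo. *)
Definition MR_choice {R : realType} {n : nat} (delta s : R)
    (Y : 'rV[R]_n) (gamma : \bar R) (u : 'rV[R]_n) : Prop :=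
  MR_admissible delta s Y gamma u /\
  forall gamma' u', MR_admissible delta s Y gamma' u' -> (gamma' <= gamma)%E.

Definition mutually_independent {d : measure_display} {T : measurableType d}
    {R : realType} (P : probability T R) (I : finType)
    (X : I -> {RV P >-> R}) : Prop :=
  forall (J : {set I}) (B : I -> set R), (forall i, measurable (B i)) ->
    P (\bigcap_(i in [set` J]) (X i @^-1` B i)) =
    (\prod_(i in J) P (X i @^-1` B i))%E.

(* Measures are only specified on measurable sets, hence the restriction. *)
Definition has_normal_law {d : measure_display} {T : measurableType d}
    {R : realType} (P : probability T R) (m s : R) (X : {RV P >-> R}) : Prop :=
  forall A : set R, measurable A -> distribution P X A = normal_prob m s A.

Definition cvg_in_probability {d : measure_display} {T : measurableType d}
    {R : realType} (P : probability T R) (X : nat -> {RV P >-> R}) (l : R) :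
    Prop :=
  forall e : R, 0 < e ->
    (fun n => P [set w | e < `|X n w - l|]) @ \oo --> 0%E.

Definition random_vector {d : measure_display} {T : measurableType d}
    {R : realType} (P : probability T R) (n : nat)
    (X : 'I_n -> {RV P >-> R}) (w : T) : 'rV[R]_n :=
  \row_i X i w.

Definition observations {d : measure_display} {T : measurableType d}
    {R : realType} (P : probability T R) (f : R -> R) (n : nat)
    (xi : 'I_n -> {RV P >-> R}) (w : T) : 'rV[R]_n :=
  \row_i (cell_mean f i + xi i w).

(* Main.v *)
Require Import Defs.
From HB Require Import structures.
From mathcomp Require Import all_boot all_order all_algebra.
From mathcomp Require Import all_classical all_reals all_analysis.
From mathcomp Require Import measurable_realfun.
From mathcomp Require Import ring lra zify.
Import Order.TTheory GRing.Theory Num.Theory.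
Import numFieldNormedType.Exports.
Set Implicit Arguments.
Unset Strict Implicit.
Unset Printing Implicit Defensive.
Local Open Scope classical_set_scope.
Local Open Scope ring_scope.

(** Write [L] for [ln n] and [K] for the number of genuine jumps of [f]. Sampling
    [f] at the left ends of the cells gives a vector [fs] with [K] jumps, and the
    observations are [fs + z], where [z] is the noise plus a bias carried by the
    at most [K] cells that contain a jump in their interior.

    The deterministic core is one identity. For a vector [u] put [w = fs - u];
    then [rss fs - rss u] is the sum of [- 2 z w - w ^ 2]. On a run of indices
    where [w] is constant, completing the square bounds this by the squared sum
    of [z] over the run divided by its length. So if the squared sum of [z] over
    every interval [I] is at most [B * #|I|], then [u] gains over [fs] at most
    [2 B] per run of [w], minus half the squared distance of [u] to [fs]
    ([segment_bound]). With [B] of order [L] this gives three facts.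
    - A minimizer for a penalty [g] with [n g] much larger than [L] has at most
      [K] jumps ([argmin_njumps_le]).
    - A vector without jump in a window around a jump of [f] is at squared
      distance of order [n] from [fs]; hence a minimizer for a small penalty
      jumps in each of the [K] windows ([argmin_njumps_ge]).
    - A vector that jumps exactly once per window makes [w] jump at most once
      between consecutive anchors, which are the jumps of [f] and the ends of
      the windows. Then every run of [w] has one of finitely many deterministic
      points as an end, and for such intervals [B] may be replaced by [c * L]
      with [c] as small as desired. So the fit is at squared distance at most
      a small multiple of [L] from [fs] ([localized_misfit]).

    By Cauchy-Schwarz the last fact shows that the residual sums of the fit for
    [gamma_n] exceed those of the noise by a small fraction of
    [sqrt (L * #|I|)], so that this fit satisfies the multiresolution bound.
    The bound compares an observation with the value of the fit at the right end
    of its cell, which is the next entry of the fit; this shift telescopes.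
    Conversely the bound forces a jump in every window ([interval_bound_hits]).
    Hence the maximal penalty is at least [gamma_n], its fit has exactly [K]
    jumps, and both fits are least squares fits with [K] jumps. Least squares
    fits with a given number of jumps are almost surely unique: a tie between
    two partitions is a zero of a nontrivial quadratic polynomial in the Gaussian
    noise ([no_ties_whp], [least_squares_unique]).

    The probabilistic core is that the sums of the noise over all intervals stay
    below [t * sigma * sqrt (L * #|I|)] for each [t] with [t ^ 2 > 2]
    ([all_noise_whp]). There are of order [n ^ 2] intervals, and the union bound
    alone would require [t ^ 2 > 4]. Rounding the ends of an interval to a dyadic
    grid much finer than its length leaves of order [n * L] intervals and two
    short remainders, for which a crude bound is enough. With one end fixed, only
    of order [L] intervals are left, and every [t > 0] is allowed
    ([anchored_noise_whp]). *)

(** * Independence from the other members of a family *)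

Section product_law.
Local Open Scope ereal_scope.
Context d d' (T : measurableType d) (T' : measurableType d') (R : realType).
Variables (P : probability T R) (Z : {mfun T >-> T'}) (X : {RV P >-> R}).

Let ZX w := (Z w, X w).

Let measurable_ZX : measurable_fun [set: T] ZX.
Proof. exact: measurable_fun_pair. Qed.

HB.instance Definition _ := @isMeasurableFun.Build _ _ _ _ ZX measurable_ZX.

Hypothesis indep : forall E A, measurable E -> measurable A ->
  P (Z @^-1` E `&` X @^-1` A) = P (Z @^-1` E) * P (X @^-1` A).

Lemma independent_product_law C : measurable C ->
  (distribution P Z \x distribution P X) C = distribution P ZX C.
Proof.
by move=> mC; apply: product_measure_unique.
Qed.

Lemma independent_ge0_expectation_mul (f : T' -> \bar R) (g : R -> \bar R) :
  measurable_fun [set: T'] f -> measurable_fun [set: R] g ->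
  (forall z, 0 <= f z) -> (forall x, 0 <= g x) ->
  \int[P]_w (f (Z w) * g (X w)) = (\int[P]_w f (Z w)) * \int[P]_w g (X w).
Proof.
move=> mf mg f0 g0.
have mfg : measurable_fun [set: T' * R] (fun zx => f zx.1 * g zx.2).
  by apply: emeasurable_funM; apply: measurableT_comp.
rewrite -[LHS](@ge0_integral_distribution _ _ _ _ _ P ZX (fun zx => f zx.1 * g zx.2))//;
  last by move=> y; exact: mule_ge0.
rewrite (eq_measure_integral (distribution P Z \x distribution P X)); last first.
  move=> C mC _; exact: esym (independent_product_law mC).
rewrite fubini_tonelli1//; last by move=> y; exact: mule_ge0.
rewrite /fubini_F /=.
under eq_integral do rewrite ge0_integralZl//.
rewrite ge0_integralZr//; last exact: integral_ge0.
by rewrite !ge0_integral_distribution.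
Qed.

(** Under the product law the measure of [C] is the integral of the measures of
    its sections. *)
Lemma independent_section_null C : measurable C ->
  (forall z, P (X @^-1` [set x | C (z, x)]) = 0) ->
  P [set w | C (Z w, X w)] = 0.
Proof.
move=> mC C0; transitivity (distribution P ZX C) => //.
rewrite -independent_product_law// /product_measure1.
apply: integral0_eq => z _ /=; rewrite -[RHS](C0 z); congr (P _).
by apply/seteqP; split => w /=; rewrite /xsection/= in_setE.
Qed.

End product_law.

Section family_independence.
Local Open Scope ereal_scope.
Context d (T : measurableType d) (R : realType) (P : probability T R).
Context (I : finType) (X : I -> {RV P >-> R}).

(** A pi-system that generates the sigma-algebra of the variables other than
    [X i]. *)
Definition cylinders_off (i : I) : set (set T) :=
  [set E | exists (J : {set I}) (B : I -> set R),
     [/\ i \notin J, (forall j, measurable (B j)) &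
         E = \bigcap_(j in [set` J]) (X j @^-1` B j)]].

Lemma cylinders_off_measurable i : cylinders_off i `<=` measurable.
Proof.
move=> _ [J [B [_ mB ->]]]; apply: fin_bigcap_measurable => // j _.
by rewrite -[_ @^-1` _]setTI; exact: measurable_funP.
Qed.

Lemma cylinders_off_setI i : setI_closed (cylinders_off i).
Proof.
move=> _ _ [J [B [iJ mB ->]]] [K [C [iK mC ->]]].
exists (J :|: K)%SET, (fun j => (if j \in J then B j else setT) `&`
                       (if j \in K then C j else setT)).
split; first by rewrite inE negb_or iJ.
  by move=> j; apply: measurableI; case: ifP.
apply/seteqP; split => w /=.
  move=> [wB wC] j /=; rewrite inE => _; split.
    by case: ifP => // jJ; exact: wB.
  by case: ifP => // jK; exact: wC.
move=> h; split => j /= jJ.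
  by have [|] := h j; rewrite /= ?inE jJ.
by have [|_] := h j; rewrite /= ?inE jJ ?orbT.
Qed.

Lemma sub_cylinders_off i j (B : set R) : j != i -> measurable B ->
  cylinders_off i (X j @^-1` B).
Proof.
move=> ji mB; exists [set j]%SET, (fun=> B); split => //.
  by rewrite inE eq_sym.
apply/seteqP; split => w /=; first by move=> wB k /=; rewrite inE => /eqP ->.
by move=> /(_ j); apply; rewrite /= inE.
Qed.

Hypothesis indep : mutually_independent X.

(** Both sides are measures in [E] that agree on the cylinders by the product
    rule, hence on the sigma-algebra that the cylinders generate. *)
Lemma independent_of_others i (A : set R) (E : set T) : measurable A ->
  <<s cylinders_off i >> E ->
  P (E `&` X i @^-1` A) = P E * P (X i @^-1` A).
Proof.
move=> mA.
have mXA : measurable (X i @^-1` A).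
  by rewrite -[_ @^-1` _]setTI; exact: measurable_funP.
have PA0 : (0 <= fine (P (X i @^-1` A)))%R by rewrite fine_ge0.
pose m2 : {measure set T -> \bar R} := mscale (NngNum PA0) P.
have m2E F : m2 F = P F * P (X i @^-1` A).
  by rewrite muleC -[P (_ @^-1` _)]fineK// fin_num_measure.
move=> sE; rewrite -m2E.
apply: (@g_sigma_algebra_measure_unique _ _ _ (cylinders_off i)
  (@cylinders_off_measurable i) (fun=> setT) _ _ (mrestr P mXA) m2 _ _ _ _ sE).
- move=> _; exists finset.set0, (fun=> setT); split => //; first by rewrite inE.
  by apply/seteqP; split => w //= _ j /=; rewrite inE.
- by rewrite bigcup_const.
- exact: cylinders_off_setI.
- move=> _ [J [B [iJ mB ->]]]; rewrite m2E.
  pose B' j := if j == i then A else B j.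
  have mB' j : measurable (B' j) by rewrite /B'; case: eqP.
  have := indep (i |: J)%SET mB'.
  rewrite big_setU1//= {1 2}/B' eqxx.
  rewrite (eq_bigr (fun j => P (X j @^-1` B j))); last first.
    by move=> j jJ; rewrite /B'; case: eqP => // ji; rewrite -ji jJ in iJ.
  rewrite -(indep J mB) muleC => <-; congr (P _); apply/seteqP; split => w /=.
    move=> [wJ wA] j /=; rewrite in_setU1 /B'; case: eqP => [-> //|_ /=].
    exact: wJ.
  move=> h; split.
    move=> j /= jJ; have := h j; rewrite /= in_setU1 jJ orbT => /(_ isT).
    by rewrite /B'; case: eqP => // ji; rewrite -ji jJ in iJ.
  by have := h i; rewrite /= in_setU1 /B'; case: eqP => // _; exact.
- by move=> k; rewrite -ge0_fin_numE//= fin_num_measure//; exact: measurableT.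
Qed.

End family_independence.

(** * Gaussian sums: tails and absence of atoms *)

Lemma measurable_set_lt d (T : measurableType d) (R : realType) (f g : T -> R) :
  measurable_fun [set: T] f -> measurable_fun [set: T] g ->
  measurable [set w | f w < g w].
Proof.
move=> mf mg; have /(_ measurableT [set true]) := measurable_fun_ltr mf mg.
by rewrite setTI; exact.
Qed.

Lemma measurable_set_le d (T : measurableType d) (R : realType) (f g : T -> R) :
  measurable_fun [set: T] f -> measurable_fun [set: T] g ->
  measurable [set w | f w <= g w].
Proof.
move=> mf mg; have /(_ measurableT [set true]) := measurable_fun_ler mf mg.
by rewrite setTI; exact.
Qed.

Lemma measurable_sum_in d (T : measurableType d) (R : realType) (D : set T)
    (I : eqType) (l : seq I) (h : I -> T -> R) :
  (forall i, i \in l -> measurable_fun D (h i)) ->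
  measurable_fun D (fun x => \sum_(i <- l) h i x).
Proof.
move=> mh.
rewrite (_ : (fun _ => _) =
    fun x => \sum_(i <- l) (if i \in l then h i else cst 0) x); last first.
  by apply/funext => x; apply: eq_big_seq => i ->.
by apply: measurable_sum => i; case: ifPn => [/mh//|_].
Qed.

Section normal_moments.
Local Open Scope ereal_scope.
Context (R : realType).
Notation mu := (@lebesgue_measure R).

(** The density is almost everywhere the Radon-Nikodym derivative. *)
Lemma ge0_integral_normal_prob (m s : R) (f : R -> \bar R) :
  measurable_fun [set: R] f -> (forall x, 0 <= f x) ->
  \int[normal_prob m s]_x f x = \int[mu]_x (f x * (normal_pdf m s x)%:E).
Proof.
move=> mf f0.
have dom := normal_prob_dominates m s.
rewrite -(Radon_Nikodym_SigmaFinite.change_of_variables dom)//.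
apply: ae_eq_integral => //.
- apply: emeasurable_funM => //.
  exact: measurable_int (Radon_Nikodym_SigmaFinite.f_integrable _).
- apply: emeasurable_funM => //=; apply/measurable_EFinP.
  exact: measurable_normal_pdf.
- apply: ae_eqe_mul2l => /=; apply: integral_ae_eq => //=.
  + exact: Radon_Nikodym_SigmaFinite.f_integrable.
  + by apply/measurable_EFinP; exact: measurable_normal_pdf.
  + by move=> E _ mE; rewrite -Radon_Nikodym_SigmaFinite.f_integral.
Qed.

(** Multiplying the density by [expR (r * x)] translates its mean to
    [r * s ^+ 2], up to the factor on the right. *)
Lemma normal_prob_expR (s r : R) : s != 0%R ->
  \int[normal_prob 0 s]_x (expR (r * x))%:E = (expR (r ^+ 2 * s ^+ 2 / 2))%:E.
Proof.
move=> s0; rewrite ge0_integral_normal_prob; last 2 first.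
- by apply/measurable_EFinP; apply: measurableT_comp => //; exact: mulrl_measurable.
- by move=> x; rewrite lee_fin expR_ge0.
transitivity (\int[mu]_x ((expR (r ^+ 2 * s ^+ 2 / 2))%:E *
    (normal_pdf (r * s ^+ 2) s x)%:E)).
  apply: eq_integral => x _; rewrite -!EFinM !normal_pdfE// /normal_fun.
  congr (_%:E); rewrite mulrCA [in RHS]mulrCA -!expRD; congr (_ * expR _)%R.
  by field.
rewrite ge0_integralZl//.
- by rewrite integral_normal_pdf mule1.
- by apply/measurable_EFinP; exact: measurable_normal_pdf.
- by move=> x _; rewrite lee_fin normal_pdf_ge0.
Qed.

Lemma normal_prob_set1 (s a : R) : normal_prob 0 s [set a] = 0.
Proof.
have := @normal_prob_dominates R 0 s.
move=> /null_content_dominatesP /(_ [set a]); apply => //.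
exact: lebesgue_measure_set1.
Qed.

End normal_moments.

Section independent_family.
Local Open Scope ereal_scope.
Context d (T : measurableType d) (R : realType) (P : probability T R).
Context (I : finType) (X : I -> {RV P >-> R}).
Hypothesis indep : mutually_independent X.

(** The underlying space with the sigma-algebra of the variables other than
    [X i]: measurability on this type means not depending on [X i]. *)
Definition sigma_off (i : I) := g_sigma_algebraType (cylinders_off X i).

Definition forget i (w : T) : sigma_off i := w.

Lemma measurable_forget i : measurable_fun [set: T] (forget i).
Proof.
move=> _ E mE; rewrite setTI preimage_id.
have : <<s (cylinders_off X i) >> `<=` @measurable _ T.
  apply: smallest_sub; [exact: sigma_algebra_measurable|].
  exact: cylinders_off_measurable.
by apply.
Qed.

HB.instance Definition _ i := @isMeasurableFun.Build _ _ T (sigma_off i)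
  (forget i) (@measurable_forget i).

Lemma measurable_other i j : j != i ->
  @measurable_fun _ _ (sigma_off i) R [set: sigma_off i] (X j).
Proof.
move=> ji _ B mB; rewrite setTI; apply: sub_sigma_algebra.
exact: sub_cylinders_off.
Qed.

Lemma expectation_mul_other i (f : sigma_off i -> \bar R) (g : R -> \bar R) :
  measurable_fun [set: sigma_off i] f -> measurable_fun [set: R] g ->
  (forall z, 0 <= f z) -> (forall x, 0 <= g x) ->
  \int[P]_w (f w * g (X i w)) = (\int[P]_w f w) * \int[P]_w g (X i w).
Proof.
move=> mf mg f0 g0.
apply: (@independent_ge0_expectation_mul _ _ _ (sigma_off i) _ P (forget i) (X i))
  => // E A mE mA.
exact: independent_of_others.
Qed.

Lemma section_null_other i (C : set (sigma_off i * R)) : measurable C ->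
  (forall z, P (X i @^-1` [set x | C (z, x)]) = 0) ->
  P [set w | C (w, X i w)] = 0.
Proof.
move=> mC C0.
apply: (@independent_section_null _ _ _ (sigma_off i) _ P (forget i) (X i)
  _ C) => // E A mE mA.
exact: independent_of_others.
Qed.

Variable s : R.
Hypothesis s_gt0 : (0 < s)%R.
Hypothesis X_normal : forall i, has_normal_law 0 s (X i).

(** The real line carries two structures of measurable type with the same
    measurable sets, one of which is the domain of the Lebesgue measure and of
    the normal laws. This is [Y] with values in that one. *)
Definition borel_copy (Y : {RV P >-> R}) (w : T) :
  measurableTypeR R := Y w.

Lemma measurable_borel_copy Y : measurable_fun [set: T] (borel_copy Y).
Proof. move=> _ B mB; have := @measurable_funP _ _ _ _ setT Y measurableT B; exact. Qed.

HB.instance Definition _ Y :=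
  @isMeasurableFun.Build _ _ _ _ (borel_copy Y) (@measurable_borel_copy Y).

Lemma normal_expectation_expR i (r : R) :
  \int[P]_w (expR (r * X i w))%:E = (expR (r ^+ 2 * s ^+ 2 / 2))%:E.
Proof.
rewrite -normal_prob_expR ?gt_eqF//.
have mf : measurable_fun [set: measurableTypeR R]
    (fun x : R => (expR (r * x))%:E).
  by apply/measurable_EFinP; apply: measurableT_comp => //; exact: mulrl_measurable.
transitivity (\int[distribution P (borel_copy (X i))]_x (expR (r * x))%:E).
  by rewrite ge0_integral_distribution// => x; rewrite lee_fin expR_ge0.
by apply: eq_measure_integral => A mA _; exact: X_normal.
Qed.

Lemma normal_sum_expectation_expR (r : R) (l : seq I) : uniq l ->
  \int[P]_w (expR (r * \sum_(i <- l) X i w))%:E =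
  (expR (r ^+ 2 * s ^+ 2 / 2 * (size l)%:R))%:E.
Proof.
elim: l => [_|i l IH] /=.
  under eq_integral do rewrite big_nil mulr0 expR0.
  by rewrite integral_cst//= probability_setT mul1e mulr0 expR0.
move=> /andP[il ul].
under eq_integral do rewrite big_cons mulrDr addrC expRD EFinM.
rewrite (@expectation_mul_other i (fun w => (expR (r * \sum_(j <- l) X j w))%:E)
  (fun x => (expR (r * x))%:E)).
- by rewrite IH// normal_expectation_expR -EFinM -expRD -(natr1 (size l)) mulrDr mulr1.
- apply/measurable_EFinP; apply: measurableT_comp => //.
  apply: measurable_funM => //; apply: measurable_sum_in => j jl.
  by apply: measurable_other; apply: contraNneq il => <-.
- by apply/measurable_EFinP; apply: measurableT_comp => //; exact: mulrl_measurable.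
- by move=> w; rewrite lee_fin expR_ge0.
- by move=> w; rewrite lee_fin expR_ge0.
Qed.

Definition scaled_sum (c : R) (l : seq I) (w : T) : R := (c * \sum_(i <- l) X i w)%R.

Lemma measurable_scaled_sum c l : measurable_fun [set: T] (scaled_sum c l).
Proof. by apply: measurable_funM => //; exact: measurable_sum. Qed.

HB.instance Definition _ c l :=
  @isMeasurableFun.Build _ _ _ _ (scaled_sum c l) (@measurable_scaled_sum c l).

(** The factor [c] is a sign, so that both tails are covered; [r] is the minimizer
    of the exponent in the Chernoff bound. *)
Lemma normal_sum_chernoff (c k x : R) (l : seq I) : (c ^+ 2 = 1)%R -> uniq l ->
  ((size l)%:R <= k)%R -> (0 < k)%R -> (0 < x)%R ->
  P [set w | (x <= scaled_sum c l w)%R] <=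
    (expR (- (x ^+ 2 / (2 * s ^+ 2 * k))))%:E.
Proof.
move=> c2 ul lk k0 x0; pose r : R := (x / (s ^+ 2 * k))%R.
have r0 : (0 < r)%R by rewrite divr_gt0// mulr_gt0// exprn_gt0.
apply: le_trans (@chernoff _ _ _ P (scaled_sum c l) r x r0) _.
have -> : mmt_gen_fun P (scaled_sum c l) r =
    (expR (r ^+ 2 * s ^+ 2 / 2 * (size l)%:R))%:E.
  rewrite (_ : r ^+ 2 * s ^+ 2 = (r * c) ^+ 2 * s ^+ 2)%R; last first.
    by rewrite [((r * c) ^+ 2)%R]exprMn c2 mulr1.
  rewrite -(@normal_sum_expectation_expR (r * c) l ul) /mmt_gen_fun unlock.
  apply: eq_integral => w _ /=.
  by rewrite /scaled_sum mulrC mulrA.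
rewrite -EFinM lee_fin -expRD ler_expR.
have -> : (- (x ^+ 2 / (2 * s ^+ 2 * k)) = r ^+ 2 * s ^+ 2 / 2 * k - r * x)%R.
  by rewrite /r; field; rewrite !gt_eqF.
by rewrite lerD2r ler_wpM2l// divr_ge0// mulr_ge0// sqr_ge0.
Qed.

Lemma normal_sum_tail (k x : R) (l : seq I) : uniq l ->
  ((size l)%:R <= k)%R -> (0 < k)%R -> (0 < x)%R ->
  P [set w | (x < `|\sum_(i <- l) X i w|)%R] <=
    (2 * expR (- (x ^+ 2 / (2 * s ^+ 2 * k))))%:E.
Proof.
move=> ul lk k0 x0.
have mA c : measurable [set w | (x <= scaled_sum c l w)%R].
  exact: measurable_set_le.
apply: (@le_trans _ _ (P ([set w | (x <= scaled_sum 1 l w)%R] `|`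
    [set w | (x <= scaled_sum (- 1) l w)%R]))).
  apply: le_measure; rewrite ?inE//; last 2 first.
  - by apply: measurableU.
  - move=> w /=; rewrite /scaled_sum mul1r mulN1r => /ltW.
    by rewrite ler_normr => /orP[]; [left|right].
  apply: measurable_set_lt => //.
  by apply: measurableT_comp => //; exact: measurable_sum.
apply: le_trans (measureU2 _ _ _) _ => //.
by rewrite mulr_natl mulr2n EFinD leeD// normal_sum_chernoff// ?expr1n// sqrrN expr1n.
Qed.

(** For fixed values of the other variables the equation has at most two roots,
    and [X i] has no atoms. *)
Lemma quadratic_null i (a : R) (b c : sigma_off i -> R) : a != 0%R ->
  measurable_fun [set: sigma_off i] b -> measurable_fun [set: sigma_off i] c ->
  P [set w | (a * X i w ^+ 2 + b w * X i w + c w)%R = 0%R] = 0.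
Proof.
move=> a0 mb mc.
pose q (zx : sigma_off i * R) := (a * zx.2 ^+ 2 + b zx.1 * zx.2 + c zx.1)%R.
have mq : measurable_fun [set: sigma_off i * R] q.
  apply: measurable_funD; last exact: measurableT_comp.
  apply: measurable_funD.
    by apply: measurable_funM => //; exact: measurable_funX.
  by apply: measurable_funM => //; exact: measurableT_comp.
apply: (@section_null_other i (q @^-1` [set 0%R])).
  by rewrite -[X in measurable X]setTI; exact: mq.
move=> z /=.
have atom t : P (X i @^-1` [set t]) = 0.
  by rewrite [LHS]X_normal// normal_prob_set1.
have mX t : measurable (X i @^-1` [set t]).
  by rewrite -[X in measurable X]setTI; exact: measurable_funP.
pose D := Num.sqrt (b z ^+ 2 - 4 * a * c z)%R.
pose t1 := ((- b z - D) / (2 * a))%R; pose t2 := ((- b z + D) / (2 * a))%R.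
apply/eqP; rewrite eq_le measure_ge0 andbT.
apply: (@le_trans _ _ (P (X i @^-1` [set t1] `|` X i @^-1` [set t2]))).
  apply: le_measure; rewrite ?inE.
  - rewrite -[X in measurable X]setTI.
    have : measurable_fun [set: T] (fun w => a * X i w ^+ 2 + b z * X i w + c z)%R.
      apply: measurable_funD => //; apply: measurable_funD => //.
        by apply: measurable_funM => //; exact: measurable_funX.
      exact: measurable_funM.
    by move=> /(_ measurableT [set 0%R]); exact.
  - exact: measurableU.
  - move=> w /=; rewrite /q/=; set x := X i w => h.
    have disc : (b z ^+ 2 - 4 * a * c z = (2 * a * x + b z) ^+ 2)%R.
      rewrite -[RHS]subr0 -(mulr0 (4 * a)%R) -h; ring.
    have hD : (D ^+ 2 = (2 * a * x + b z) ^+ 2)%R.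
      rewrite sqr_sqrtr; last first.
        by rewrite disc sqr_ge0.
      exact: disc.
    have a20 : (2 * a != 0)%R by rewrite mulf_neq0.
    move/eqP: hD; rewrite eqf_sqr => /orP[/eqP hD|/eqP hD]; [right|left].
      by rewrite /t2 hD; field.
    by rewrite /t1 hD; field.
apply: (@le_trans _ _ (P (X i @^-1` [set t1]) + P (X i @^-1` [set t2]))).
  exact: measureU2.
by rewrite !atom adde0.
Qed.

End independent_family.

(** * Events of probability tending to one *)

Section with_high_probability.
Context d (T : measurableType d) (R : realType) (P : probability T R).

(** The complement is only required to lie in a small measurable set, so that
    the events need not be measurable themselves. *)
Definition whp (A : nat -> set T) : Prop :=
  forall e : R, 0 < e -> \forall n \near \oo,
    exists B, [/\ measurable B, ~` A n `<=` B & (P B <= e%:E)%E].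

Lemma whp_sub (A B : nat -> set T) :
  (\forall n \near \oo, A n `<=` B n) -> whp A -> whp B.
Proof.
move=> AB hA e e0; near=> n.
have [C [mC AC PC]] : exists C, [/\ measurable C, ~` A n `<=` C & (P C <= e%:E)%E].
  by near: n; exact: hA.
exists C; split => //; apply: subset_trans AC; apply: subsetC.
by near: n.
Unshelve. all: by end_near. Qed.

Lemma whpI (A B : nat -> set T) : whp A -> whp B -> whp (fun n => A n `&` B n).
Proof.
move=> hA hB e e0; have e20 : 0 < e / 2 by rewrite divr_gt0.
near=> n.
have [C [mC AC PC]] : exists C, [/\ measurable C, ~` A n `<=` C & (P C <= (e / 2)%:E)%E].
  by near: n; exact: hA.
have [D [mD BD PD]] : exists C, [/\ measurable C, ~` B n `<=` C & (P C <= (e / 2)%:E)%E].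
  by near: n; exact: hB.
exists (C `|` D); split; first exact: measurableU.
  by rewrite setCI; exact: setUSS.
apply: le_trans (measureU2 _ _ _) _ => //.
by rewrite [e]splitr EFinD leeD.
Unshelve. all: by end_near. Qed.

Lemma whp_bigI (K : nat) (A : nat -> nat -> set T) :
  (forall k, (k < K)%N -> whp (A k)) ->
  whp (fun n => [set w | forall k, (k < K)%N -> A k n w]).
Proof.
elim: K => [_|K IH hA].
  move=> e e0; near=> n; exists set0; split => //; last by rewrite measure0 lee_fin ltW.
  by move=> w /=; apply; move=> k; rewrite ltn0.
have := whpI (IH (fun k hk => hA k (ltnW hk))) (hA K (ltnSn K)).
apply: whp_sub; near=> n => w /= [h1 h2] k; rewrite ltnS leq_eqVlt.
by move=> /orP[/eqP -> //|]; exact: h1.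
Unshelve. all: by end_near. Qed.

Lemma ae_whp (A : nat -> set T) : {ae P, forall w, forall n, A n w} -> whp A.
Proof.
move=> [N [mN PN AN]] e e0; near=> n; exists N; split => //.
  by apply: subset_trans AN => w /= h hn; apply: h.
by rewrite [P N]PN lee_fin ltW.
Unshelve. all: by end_near. Qed.

Lemma cvg0_whp (A : nat -> set T) : (forall n, measurable (A n)) ->
  P (~` A n) @[n --> \oo] --> 0%E -> whp A.
Proof.
move=> mA /fine_cvgP[_ /cvgrPdist_le h] e e0; near=> n.
exists (~` A n); split => //; first exact: measurableC.
have : `|0 - fine (P (~` A n))| <= e by near: n; exact: h.
rewrite sub0r normrN ger0_norm ?fine_ge0// => h1.
by rewrite -[P _]fineK ?lee_fin// fin_num_measure//; exact: measurableC.
Unshelve. all: by end_near. Qed.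

(** The sets of points that are outside [A k] for some [k >= n] decrease to a
    null set. *)
Lemma ae_eventually_whp (A : nat -> set T) : (forall n, measurable (A n)) ->
  {ae P, forall w, \forall n \near \oo, A n w} -> whp A.
Proof.
move=> mA [N [mN PN AN]].
pose B n := \bigcup_(k in [set k | (n <= k)%N]) ~` A k.
have mB n : measurable (B n).
  by apply: bigcup_measurable => k _; exact: measurableC.
have : P (B n) @[n --> \oo] --> P (\bigcap_n B n).
  apply: nonincreasing_cvg_mu => //.
  - by rewrite -ge0_fin_numE// fin_num_measure.
  - exact: bigcapT_measurable.
  - move=> m n mn; apply/subsetPset => w [k /= nk Akw]; exists k => //=.
    exact: leq_trans nk.
have -> : P (\bigcap_n B n) = 0%E.
  apply/eqP; rewrite -measure_le0 -PN le_measure ?inE//.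
    exact: bigcapT_measurable.
  move=> w hw; apply: AN => /= -[n _ hn]; have [k /= nk] := hw n I.
  by apply; exact: hn.
move=> h; have {h}: whp (fun n => ~` B n).
  by apply: cvg0_whp => [n|]; [exact: measurableC|under eq_fun do rewrite setCK].
apply: whp_sub; near=> n => w /= hw; apply: contrapT => nA; apply: hw.
by exists n => //=.
Unshelve. all: by end_near. Qed.

Lemma whp_cvg1 (A : nat -> set T) : (\forall n \near \oo, measurable (A n)) ->
  whp A -> P (A n) @[n --> \oo] --> 1%E.
Proof.
move=> mA hA; apply/fine_cvgP; split.
  by near=> n; rewrite fin_num_measure//; near: n.
apply/cvgrPdist_le => e e0; near=> n.
have mAn : measurable (A n) by near: n.
have [C [mC AC PC]] : exists C, [/\ measurable C, ~` A n `<=` C & (P C <= e%:E)%E].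
  by near: n; exact: hA.
have : (P (~` A n) <= e%:E)%E.
  by apply: le_trans PC; rewrite le_measure ?inE//; exact: measurableC.
rewrite probability_setC// -[P _]fineK ?fin_num_measure//= -EFinB lee_fin.
move=> h; rewrite ger0_norm// subr_ge0 -lee_fin fineK ?fin_num_measure//.
exact: probability_le1.
Unshelve. all: by end_near. Qed.

End with_high_probability.

Section log_asymptotics.
Context (R : realType).

Lemma near_ln_ge (M : R) : \forall n \near \oo, M <= ln (n%:R : R).
Proof.
near=> n; have : expR M <= n%:R by near: n; exact: nbhs_infty_ger.
move=> h; rewrite -[M]expRK ler_ln// ?posrE ?expR_gt0//.
exact: lt_le_trans (expR_gt0 M) h.
Unshelve. all: by end_near. Qed.

(** Squaring [1 + x <= expR x] shows that the exponential beats the linear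
    factor. *)
Lemma near_ln_decay (C q e : R) : 0 <= C -> 0 < q -> 0 < e ->
  \forall n \near \oo, C * (1 + ln (n%:R : R)) * expR (- (q * ln n%:R)) <= e.
Proof.
move=> C0 q0 e0; pose K : R := 1 + 2 / q.
near=> n.
have : 0 <= ln (n%:R : R) by near: n; exact: near_ln_ge.
have : 2 * C * K / (q * e) <= ln (n%:R : R) by near: n; exact: near_ln_ge.
set L := ln n%:R => LM L0.
rewrite expRN ler_pdivrMr ?expR_gt0//.
have h1 : 1 + q * L / 2 <= expR (q * L / 2) by exact: expR_ge1Dx.
have h0 : 0 <= 1 + q * L / 2 by rewrite addr_ge0// !mulr_ge0// ltW.
have -> : expR (q * L) = expR (q * L / 2) ^+ 2 by rewrite -expRM_natl; congr expR; field.
have h2 : (1 + q * L / 2) ^+ 2 <= expR (q * L / 2) ^+ 2 by rewrite lerXn2r ?nnegrE ?expR_ge0.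
apply: le_trans (ler_wpM2l (ltW e0) h2).
have K0 : 0 <= K by rewrite addr_ge0// divr_ge0// ltW.
have h3 : C * K <= e * (1 + q * L / 2).
  move: LM; rewrite ler_pdivrMr ?mulr_gt0//; nra.
have h4 : 1 + L <= K * (1 + q * L / 2).
  have -> : K * (1 + q * L / 2) = 1 + L + (2 / q + q * L / 2).
    by rewrite /K; field; rewrite gt_eqF.
  by rewrite lerDl addr_ge0// ?divr_ge0// ?mulr_ge0// ltW.
apply: (@le_trans _ _ (C * K * (1 + q * L / 2))).
  by rewrite -mulrA ler_wpM2l.
by rewrite expr2 mulrA ler_wpM2r.
Unshelve. all: by end_near. Qed.

Lemma near_ln_le (e : R) : 0 < e -> \forall n \near \oo, ln (n%:R : R) <= e * n%:R.
Proof.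
move=> e0; have h := @near_ln_decay 1 1 e ler01 ltr01 e0; near=> n.
have n0 : 0 < n%:R :> R by near: n; exact: nbhs_infty_gtr.
have : 1 * (1 + ln (n%:R : R)) * expR (- (1 * ln n%:R)) <= e by near: n.
rewrite !mul1r expRN lnK ?posrE// ler_pdivrMr//; apply: le_trans.
by rewrite lerDr.
Unshelve. all: by end_near. Qed.

End log_asymptotics.

(** * Noise over intervals *)

(** The scale [2 ^ j] is comparable to [l / m], except that it is [1] for the
    intervals shorter than [m], whose ends need no rounding. *)
Lemma dyadic_scale (m n l : nat) : (0 < m)%N -> (0 < l <= n)%N ->
  exists j, [/\ (j <= trunc_log 2 n)%N, (l < 2 ^ j * m * 2)%N &
                j = 0%N \/ (2 ^ j * m <= l)%N].
Proof.
move=> m0 /andP[l0 ln]; have [lm|ml] := ltnP l m.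
  by exists 0%N; split => //; [rewrite expn0; lia|left].
have lm0 : (0 < l %/ m)%N by rewrite divn_gt0.
have /andP[h1 h2] := @trunc_log_bounds 2 _ (isT : (1 < 2)%N) lm0.
exists (trunc_log 2 (l %/ m)); split.
- apply: leq_trunc_log; apply: leq_trans (leq_div _ _) ln.
- by move: h2; rewrite expnS ltn_divLR//; lia.
- by right; move: h1; rewrite leq_divRL.
Qed.

(** Rounding to multiples of [2 ^ j] inwards shortens either end by less than
    [2 ^ j], which is at most [(b - a) / m] or equal to [1]. The indices [j], [p]
    and [k] take of order [n * ln n] values altogether. *)
Lemma dyadic_rounding (m n a b : nat) : (1 < m)%N -> (a < b)%N -> (b <= n)%N ->
  exists j p k c e,
    [/\ (j <= trunc_log 2 n)%N, (p <= n)%N, (k < 2 * m)%N, c = (2 ^ j * p)%N &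
        e = (c + 2 ^ j * k)%N] /\
    [/\ (a <= c)%N, (c <= e)%N, (e <= b)%N, ((c - a) * m <= b - a)%N &
        ((b - e) * m <= b - a)%N].
Proof.
move=> m2 ab bn.
have [||j [hj hlt hor]] := @dyadic_scale m n (b - a); [lia|lia|].
have [g gE] : exists g, g = (2 ^ j)%N by exists (2 ^ j)%N.
have g0 : (0 < g)%N by rewrite gE expn_gt0.
rewrite -gE in hlt hor *; exists j; rewrite -gE.
suff [p [q [hap hpq hqb hr1 hr2]]] : exists p q, [/\ (a <= g * p)%N, (p <= q)%N,
    (g * q <= b)%N, ((g * p - a) * m <= b - a)%N & ((b - g * q) * m <= b - a)%N].
  exists p, (q - p)%N, (g * p)%N, (g * p + g * (q - p))%N.
  have E : (g * p + g * (q - p) = g * q)%N by rewrite -mulnDr subnKC.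
  split; split => //; rewrite ?E//; last by rewrite leq_mul2l hpq orbT.
    by apply: leq_trans bn; apply: leq_trans hqb; apply: leq_trans hpq _; rewrite leq_pmull.
  rewrite mulnC -(ltn_pmul2l g0) mulnA; apply: leq_ltn_trans hlt.
  by rewrite mulnBr; apply: leq_sub.
case: hor => [j0|hge].
  exists a, b; rewrite gE j0 expn0 !mul1n !subnn; split => //; exact: ltnW.
have ha := divn_eq (a + g.-1) g; have hb := divn_eq b g.
have ra := ltn_pmod (a + g.-1) g0; have rb := ltn_pmod b g0.
exists ((a + g.-1) %/ g)%N, (b %/ g)%N.
move: ((a + g.-1) %/ g)%N ((a + g.-1) %% g)%N (b %/ g)%N (b %% g)%N ha hb ra rb.
clear gE hlt => p r q r' ha hb ra rb.
have hap : (a <= g * p)%N by lia.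
have hap' : (g * p - a <= g)%N by lia.
have hbq : (b - g * q <= g)%N by lia.
have pq : (g * p < g * q.+1)%N by nia.
split => //.
- by move: pq; rewrite ltn_pmul2l.
- by rewrite hb mulnC leq_addr.
- by apply: leq_trans hge; rewrite leq_mul2r hap' orbT.
- by apply: leq_trans hge; rewrite leq_mul2r hbq orbT.
Qed.

Section noise_intervals.
Context d (T : measurableType d) (R : realType) (P : probability T R).
Context (sigma : R) (xi : forall n, 'I_n -> {RV P >-> R}).
Hypothesis sigma_gt0 : 0 < sigma.
Hypothesis xi_normal : forall n (i : 'I_n), has_normal_law 0 sigma (xi i).
Hypothesis xi_indep : forall n, mutually_independent (@xi n).

Definition noise n (w : T) (a b : nat) : R :=
  \sum_(i < n | (a <= i < b)%N) xi i w.

Lemma noise_cat n w a b c : (a <= b <= c)%N ->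
  noise n w a c = noise n w a b + noise n w b c.
Proof.
move=> /andP[ab bc]; rewrite /noise (bigID (fun i : 'I_n => (i < b)%N))/=.
congr (_ + _); apply: eq_bigl => i; lia.
Qed.

Lemma noise0 n w a b : (b <= a)%N -> noise n w a b = 0.
Proof. by move=> ba; rewrite /noise big_pred0// => i; lia. Qed.

Lemma measurable_noise n a b : measurable_fun [set: T] (fun w => noise n w a b).
Proof.
rewrite /noise; under eq_fun do rewrite -big_filter.
exact: measurable_sum.
Qed.

Lemma size_interval n a b :
  (size [seq i <- index_enum 'I_n | (a <= (i : 'I_n) < b)%N] <= b - a)%N.
Proof.
rewrite -[leqRHS](size_iota a) -(size_map val).
apply: uniq_leq_size.
  by rewrite map_inj_uniq; [rewrite filter_uniq// index_enum_uniq|exact: val_inj].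
move=> k /mapP[i]; rewrite mem_filter => /andP[h _] -> /=; rewrite mem_iota; lia.
Qed.

Definition noise_gt (t : R) n a b : set T :=
  [set w | sigma * t * Num.sqrt (ln n%:R * (b - a)%:R) < `|noise n w a b| ].

Lemma noise_tail n a b (t : R) : 0 < t -> 0 < ln (n%:R : R) ->
  (P (noise_gt t n a b)
   <= (2 * expR (- (t ^+ 2 / 2 * ln n%:R)))%:E)%E.
Proof.
move=> t0 L0; have [ba|ab] := leqP b a.
  rewrite (_ : noise_gt t n a b = set0) ?measure0 ?lee_fin ?mulr_ge0 ?expR_ge0//.
  apply/seteqP; split => w //=; rewrite /noise_gt/= noise0// normr0 ltNge.
  by rewrite mulr_ge0 ?sqrtr_ge0// mulr_ge0// ltW.
have k0 : 0 < (b - a)%:R :> R by rewrite ltr0n subn_gt0.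
rewrite /noise_gt; set x := sigma * t * _.
have x0 : 0 < x by rewrite !mulr_gt0// sqrtr_gt0 mulr_gt0.
have -> : t ^+ 2 / 2 * ln n%:R = x ^+ 2 / (2 * sigma ^+ 2 * (b - a)%:R).
  rewrite /x !exprMn sqr_sqrtr ?mulr_ge0 ?ltW//; field.
  by rewrite !gt_eqF.
rewrite /noise; under eq_set => w do rewrite -big_filter.
apply: normal_sum_tail => //.
- by rewrite filter_uniq// index_enum_uniq.
- by rewrite ler_nat size_interval.
Qed.

(** The normalization is such that one interval violates the bound with
    probability at most [2 * n ^- (t ^ 2 / 2)]. *)
Definition noise_le (t : R) n w (ab : nat * nat) : Prop :=
  `|noise n w ab.1 ab.2| <= sigma * t * Num.sqrt (ln n%:R * (ab.2 - ab.1)%:R).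

Lemma noise_family_tail n (t : R) (F : seq (nat * nat)) : 0 < t ->
  0 < ln (n%:R : R) ->
  exists B, [/\ measurable B, ~` [set w | {in F, forall ab, noise_le t n w ab}] `<=` B &
    (P B <= ((size F)%:R * (2 * expR (- (t ^+ 2 / 2 * ln n%:R))))%:E)%E].
Proof.
move=> t0 L0; elim: F => [|[a b] F [B [mB FB PB]]].
  exists set0; split => //; last by rewrite measure0 mul0r.
  by move=> w /=; apply; move=> ab; rewrite in_nil.
exists (B `|` noise_gt t n a b).
have mN : measurable (noise_gt t n a b).
  apply: measurable_set_lt => //; apply: measurableT_comp => //.
  exact: measurable_noise.
split; first exact: measurableU.
  move=> w /= nF; apply: contrapT => /not_orP[nB /negP]; rewrite -leNgt => nN.
  apply: nF => -[a' b']; rewrite in_cons => /orP[/eqP[-> ->] //|abF].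
  by have := contrapT (fun h => nB (FB w h)); apply.
apply: (@le_trans _ _ (P B + P (noise_gt t n a b))%E).
  exact: measureU2.
by rewrite /= -(natr1 (size F)) mulrDl mul1r EFinD leeD// noise_tail.
Qed.

(** The union bound over a family of at most about [n ^ p] intervals. *)
Lemma noise_family_whp (t p C : R) (F : nat -> seq (nat * nat)) :
  0 < t -> p < t ^+ 2 / 2 -> 0 <= C ->
  (forall n, (0 < n)%N -> (size (F n))%:R <= C * (1 + ln n%:R) * expR (p * ln n%:R)) ->
  whp P (fun n => [set w | {in F n, forall ab, noise_le t n w ab}]).
Proof.
move=> t0 pt C0 sF e e0.
have q0 : 0 < t ^+ 2 / 2 - p by rewrite subr_gt0.
have C20 : 0 <= 2 * C by rewrite mulr_ge0.
have h := near_ln_decay C20 q0 e0.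
near=> n.
have L0 : 0 < ln (n%:R : R).
  by apply: (@lt_le_trans _ _ 1) => //; near: n; exact: near_ln_ge.
have n0 : (0 < n)%N by near: n; exact: nbhs_infty_gt.
have he : 2 * C * (1 + ln (n%:R : R)) * expR (- ((t ^+ 2 / 2 - p) * ln n%:R)) <= e.
  by near: n.
have [B [mB FB PB]] := @noise_family_tail n t (F n) t0 L0.
exists B; split => //; apply: le_trans PB _; rewrite lee_fin; apply: le_trans he.
apply: le_trans (ler_wpM2r _ (sF n n0)) _; first by rewrite mulr_ge0 ?expR_ge0.
rewrite le_eqVlt; apply/orP; left; apply/eqP.
have -> : - ((t ^+ 2 / 2 - p) * ln n%:R) = p * ln n%:R + - (t ^+ 2 / 2 * ln n%:R).
  by ring.
by rewrite expRD; ring.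
Unshelve. all: by end_near. Qed.

Definition all_noise_le (t : R) n w : Prop :=
  forall a b, (a <= b <= n)%N -> noise_le t n w (a, b).

(** The plain union bound: there are of order [n ^ 2] intervals and
    [3 ^ 2 / 2 > 2]. *)
Lemma all_noise3_whp : whp P (fun n => [set w | all_noise_le 3 n w]).
Proof.
pose F n := [seq (a, b) | a <- iota 0 n.+1, b <- iota 0 n.+1].
apply: whp_sub (@noise_family_whp 3 2 4 F _ _ _ _) => //; last 2 first.
- by rewrite ltr_pdivlMr//; lra.
- move=> n n0; rewrite size_allpairs !size_iota.
  have n1 : 1 <= n%:R :> R by rewrite ler1n.
  have -> : expR (2 * ln (n%:R : R)) = n%:R ^+ 2.
    by rewrite expRM_natl lnK// posrE ltr0n.
  have L0 : 0 <= ln (n%:R : R) by exact: ln_ge0.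
  by rewrite natrM -(natr1 n); nra.
near=> n => w /= h a b /andP[ab bn]; apply: h.
by apply/allpairsP; exists (a, b); split; rewrite ?mem_iota //=; lia.
Unshelve. all: by end_near. Qed.

Lemma trunc_log_le_ln n : (0 < n)%N -> (trunc_log 2 n)%:R <= 2 * ln (n%:R : R).
Proof.
move=> n0; have h := trunc_logP (isT : (1 < 2)%N) n0.
have : ln ((2 ^ trunc_log 2 n)%:R : R) <= ln n%:R.
  by rewrite ler_ln ?posrE ?ltr0n ?expn_gt0// ler_nat.
rewrite natrX lnXn// -[_ *+ trunc_log _ _]mulr_natr.
have l2 : 1 / 2 <= ln (2 : R).
  have : 1 / 2 <= - ln (1 / 2 : R).
    have : ln (1 + - (1 / 2) : R) <= - (1 / 2) by apply: le_ln1Dx; lra.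
    rewrite (_ : 1 + - (1 / 2) = 1 / 2); last by field.
    by rewrite lerNr.
  by rewrite -lnV ?posrE// invf_div divr1.
move=> hL; have t0 : 0 <= (trunc_log 2 n)%:R :> R by [].
by have := ler_wpM2r t0 l2; lra.
Qed.

(** For a remainder [m] times shorter than the interval of length [l] that it is
    part of, the crude bound gains the factor [sqrt m]. *)
Lemma noise_le_rem (t : R) n w a b l (m : nat) : (0 < n)%N -> (0 < m)%N ->
  0 < t -> noise_le t n w (a, b) -> ((b - a) * m <= l)%N ->
  `|noise n w a b| <= sigma * (t / Num.sqrt m%:R) * Num.sqrt (ln n%:R * l%:R).
Proof.
move=> n0 m0 t0 h bal; apply: le_trans h _ => /=.
have sm0 : 0 < Num.sqrt (m%:R : R) by rewrite sqrtr_gt0 ltr0n.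
have L0 : 0 <= ln (n%:R : R) by apply: ln_ge0; rewrite ler1n.
rewrite -!mulrA ler_pM2l// ler_pM2l// ler_pdivlMl// -sqrtrM// ler_wsqrtr//.
have : ((b - a) * m)%:R <= l%:R :> R by rewrite ler_nat.
by rewrite natrM => h; rewrite mulrCA ler_wpM2l// mulrC.
Qed.

(** Rounding the length of an interval that starts or ends at [a n] to a multiple
    of a dyadic scale leaves of order [ln n] intervals, so the union bound costs
    no power of [n]. *)
Lemma anchored_noise_whp (t : R) (a : nat -> nat) : 0 < t ->
  whp P (fun n => [set w | forall b, (b <= n)%N -> (a n <= n)%N ->
    noise_le t n w (a n, b) /\ noise_le t n w (b, a n)]).
Proof.
move=> t0; have t20 : 0 < t / 2 by rewrite divr_gt0.
have [m [m0 hm]] : exists m, (0 < m)%N /\ 3 / Num.sqrt (m%:R : R) <= t / 2.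
  near \oo => m; exists m; split; first by near: m; exact: nbhs_infty_gt.
  have m0 : 0 < m%:R :> R by near: m; exact: nbhs_infty_gtr.
  rewrite ler_pdivrMr ?sqrtr_gt0// mulrC -ler_pdivrMr//.
  rewrite -[leLHS]ger0_norm; last by rewrite divr_ge0// ltW.
  rewrite -sqrtr_sqr ler_wsqrtr//; near: m; exact: nbhs_infty_ger.
pose J n := (trunc_log 2 n).+1.
pose F n := [seq (a n, (a n + 2 ^ j * k)%N) | j <- iota 0 (J n), k <- iota 0 (2 * m)].
pose G n := [seq ((a n - 2 ^ j * k)%N, a n) | j <- iota 0 (J n), k <- iota 0 (2 * m)].
have size_bound n : (0 < n)%N ->
    (J n * (2 * m))%:R <= (4 * m)%:R * (1 + ln n%:R) * expR (0 * ln (n%:R : R)).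
  move=> n0; rewrite mul0r expR0 mulr1 !natrM /J -(natr1 (trunc_log 2 n)).
  have := trunc_log_le_ln n0; have := ler0n R m; nra.
have hF : whp P (fun n => [set w | {in F n, forall ab, noise_le (t / 2) n w ab}]).
  apply: (@noise_family_whp _ 0 (4 * m)%:R) => //.
  - by rewrite divr_gt0// exprn_gt0.
  - by move=> n n0; rewrite size_allpairs !size_iota; exact: size_bound.
have hG : whp P (fun n => [set w | {in G n, forall ab, noise_le (t / 2) n w ab}]).
  apply: (@noise_family_whp _ 0 (4 * m)%:R) => //.
  - by rewrite divr_gt0// exprn_gt0.
  - by move=> n n0; rewrite size_allpairs !size_iota; exact: size_bound.
apply: whp_sub (whpI (whpI hF hG) all_noise3_whp); near=> n.
have n0 : (0 < n)%N by near: n; exact: nbhs_infty_gt.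
have L0 : 0 <= ln (n%:R : R) by apply: ln_ge0; rewrite ler1n.
move=> w /= [[wF wG] w3] b bn an.
have split_le x y l : x <= sigma * (t / 2) * Num.sqrt (ln n%:R * l%:R) ->
    y <= sigma * (3 / Num.sqrt m%:R) * Num.sqrt (ln n%:R * l%:R) ->
    x + y <= sigma * t * Num.sqrt (ln n%:R * l%:R).
  move=> hx hy; apply: le_trans (lerD hx hy) _.
  rewrite -!mulrDl -mulrDr ler_wpM2r ?sqrtr_ge0// ler_pM2l//; lra.
have coarse x y l : (y - x <= l)%N -> noise_le (t / 2) n w (x, y) ->
    `|noise n w x y| <= sigma * (t / 2) * Num.sqrt (ln n%:R * l%:R).
  move=> yx h; apply: le_trans h _ => /=.
  apply: ler_wpM2l; first by rewrite mulr_ge0// ltW.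
  by apply: ler_wsqrtr; apply: ler_wpM2l => //; rewrite ler_nat.
have scale l : (0 < l <= n)%N -> exists j k p r,
    [/\ j \in iota 0 (J n), k \in iota 0 (2 * m), (r * m <= l)%N,
      p = (2 ^ j * k)%N & l = (p + r)%N].
  move=> hl; have [j [hj hlt hor]] := dyadic_scale m0 hl.
  exists j, (l %/ 2 ^ j)%N, (2 ^ j * (l %/ 2 ^ j))%N, (l %% 2 ^ j)%N.
  rewrite !mem_iota /J; split => //; last by rewrite mulnC -divn_eq.
    by rewrite /= add0n ltn_divLR ?expn_gt0//; lia.
  case: hor => [->|hge]; first by rewrite expn0 modn1.
  by apply: leq_trans hge; rewrite leq_mul2r ltnW ?orbT// ltn_pmod// expn_gt0.
split.
  have [ba|ab] := leqP b (a n).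
    by rewrite /noise_le/= noise0// normr0 !mulr_ge0 ?sqrtr_ge0// ltW.
  have [|j [k [p [r [hj hk hr hp hl]]]]] := scale (b - a n)%N; first lia.
  rewrite /noise_le/= (@noise_cat n w _ (a n + p)); last lia.
  apply: le_trans (ler_normD _ _) _; apply: split_le.
    apply: coarse; first by rewrite addKn hl leq_addr.
    by apply: wF; rewrite hp; apply/allpairsP; exists (j, k).
  apply: noise_le_rem => //; first by apply: w3; lia.
  by rewrite (_ : (b - (a n + p) = r)%N)//; lia.
have [ab|ba] := leqP (a n) b.
  by rewrite /noise_le/= noise0// normr0 !mulr_ge0 ?sqrtr_ge0// ltW.
have [|j [k [p [r [hj hk hr hp hl]]]]] := scale (a n - b)%N; first lia.
rewrite /noise_le/= (@noise_cat n w _ (a n - p)); last lia.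
rewrite addrC; apply: le_trans (ler_normD _ _) _; apply: split_le.
  apply: coarse; first by rewrite hl; lia.
  by apply: wG; rewrite hp; apply/allpairsP; exists (j, k).
apply: noise_le_rem => //; first by apply: w3; lia.
by rewrite (_ : (a n - p - b = r)%N)//; lia.
Unshelve. all: by end_near. Qed.

(** Rounding both ends leaves of order [n * ln n] intervals, so the union bound
    costs one power of [n] only: whence the condition on [t]. *)
Lemma all_noise_whp (t : R) : 0 < t -> 2 < t ^+ 2 ->
  whp P (fun n => [set w | all_noise_le t n w]).
Proof.
move=> t0 t2.
(* [t'] is for the grid intervals, [t - t'] for the two remainders *)
have [t' [t'0 t'2 t't]] : exists t' : R, [/\ 0 < t', 2 < t' ^+ 2 & t' < t].
  pose q := Num.sqrt (2 : R).
  have q0 : 0 < q by rewrite sqrtr_gt0.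
  have q2 : q ^+ 2 = 2 by rewrite sqr_sqrtr.
  have qt : q < t by rewrite -(@ltr_pXn2r _ 2) ?nnegrE ?ltW// q2.
  exists ((q + t) / 2); split; [lra| |lra].
  by rewrite -[ltLHS]q2 ltr_pXn2r ?nnegrE//; lra.
have d0 : 0 < t - t' by rewrite subr_gt0.
have [m [m2 hm]] : exists m, (1 < m)%N /\ 3 / Num.sqrt (m%:R : R) <= (t - t') / 2.
  near \oo => m; exists m; split; first by near: m; exact: nbhs_infty_gt.
  have m0 : 0 < m%:R :> R by near: m; exact: nbhs_infty_gtr.
  rewrite ler_pdivrMr ?sqrtr_gt0// mulrC -ler_pdivrMr ?divr_gt0//.
  rewrite -[leLHS]ger0_norm; last by rewrite divr_ge0// ltW// divr_gt0.
  rewrite -sqrtr_sqr ler_wsqrtr//; near: m; exact: nbhs_infty_ger.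
have m0 : (0 < m)%N by apply: ltnW.
pose J n := (trunc_log 2 n).+1.
pose F n := [seq ((2 ^ jp.1 * jp.2)%N, (2 ^ jp.1 * jp.2 + 2 ^ jp.1 * k)%N) |
  jp <- [seq (j, p) | j <- iota 0 (J n), p <- iota 0 n.+1], k <- iota 0 (2 * m)].
have hF : whp P (fun n => [set w | {in F n, forall ab, noise_le t' n w ab}]).
  apply: (@noise_family_whp _ 1 (8 * m)%:R) => //.
  - by rewrite ltr_pdivlMr// mul1r.
  - move=> n n0; rewrite !size_allpairs !size_iota mul1r lnK ?posrE ?ltr0n//.
    have := trunc_log_le_ln n0; rewrite !natrM /J -(natr1 (trunc_log 2 n)) -(natr1 n).
    have : 1 <= n%:R :> R by rewrite ler1n.
    have : 0 <= ln (n%:R : R) by apply: ln_ge0; rewrite ler1n.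
    have := ler0n R (trunc_log 2 n).
    move: (n%:R : R) ((trunc_log 2 n)%:R : R) (ln (n%:R : R)) => N K L K0 L0 N1 KL.
    have h : (K + 1) * (N + 1) <= (2 * (1 + L)) * (2 * N) by apply: ler_pM; lra.
    have h' : 0 <= 2 * (m%:R : R) by rewrite mulr_ge0.
    by have := ler_wpM2r h' h; lra.
apply: whp_sub (whpI hF all_noise3_whp); near=> n.
have n0 : (0 < n)%N by near: n; exact: nbhs_infty_gt.
have L0 : 0 <= ln (n%:R : R) by apply: ln_ge0; rewrite ler1n.
move=> w /= [wF w3] a b /andP[ab bn].
have [ba|{}ab] := leqP b a.
  by rewrite /noise_le/= noise0// normr0 !mulr_ge0 ?sqrtr_ge0// ltW.
have [j [p [k [c [e' [[hj hp hk cE eE] [ac ce eb hr1 hr2]]]]]]] := dyadic_rounding m2 ab bn.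
have en : (e' <= n)%N := leq_trans eb bn.
have hgrid : noise_le t' n w (c, e').
  apply: wF; apply/allpairsP; exists ((j, p), k); split; last by rewrite /= -cE -eE.
    by apply/allpairsP; exists (j, p); rewrite !mem_iota !add0n !ltnS.
  by rewrite mem_iota add0n.
rewrite /noise_le/= (@noise_cat n w _ c); last by rewrite ac (leq_trans ce eb).
rewrite (@noise_cat n w c e'); last by rewrite ce.
have h1 : `|noise n w a c| <=
    sigma * (3 / Num.sqrt m%:R) * Num.sqrt (ln n%:R * (b - a)%:R).
  by apply: noise_le_rem => //; apply: w3; rewrite ac (leq_trans ce en).
have h3 : `|noise n w e' b| <=
    sigma * (3 / Num.sqrt m%:R) * Num.sqrt (ln n%:R * (b - a)%:R).
  by apply: noise_le_rem => //; apply: w3; rewrite eb.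
have h2 : `|noise n w c e'| <= sigma * t' * Num.sqrt (ln n%:R * (b - a)%:R).
  apply: le_trans hgrid _ => /=; apply: ler_wpM2l; first by rewrite mulr_ge0// ltW.
  by apply: ler_wsqrtr; apply: ler_wpM2l => //; rewrite ler_nat leq_sub.
apply: le_trans (ler_normD _ _) _; apply: le_trans (lerD h1 (ler_normD _ _)) _.
apply: le_trans (lerD (lexx _) (lerD h2 h3)) _.
rewrite -!mulrDl -!mulrDr; apply: ler_wpM2r; first exact: sqrtr_ge0.
by rewrite ler_pM2l//; lra.
Unshelve. all: by end_near. Qed.

End noise_intervals.

(** * Least squares fits on partitions and the absence of ties *)

Section partitions.
Context (n : nat).
Implicit Types (A : {set 'I_n}) (i j k : 'I_n).

(** A set [A] of indices stands for the partition into runs of consecutive indices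
    that is cut between [i] and [i.+1] for the [i] in [A]. *)
Definition same_block A i j : bool :=
  [forall k : 'I_n, (minn i j <= k < maxn i j)%N ==> (k \notin A)].

Lemma same_blockP A i j :
  reflect (forall k, (minn i j <= k < maxn i j)%N -> k \notin A) (same_block A i j).
Proof. exact: forall_inP. Qed.

Lemma same_block_refl A i : same_block A i i.
Proof. by apply/same_blockP => k; rewrite minnn maxnn; lia. Qed.

Lemma same_block_sym A i j : same_block A i j = same_block A j i.
Proof. by rewrite /same_block minnC maxnC. Qed.

Lemma same_block_trans A i j k :
  same_block A i j -> same_block A j k -> same_block A i k.
Proof.
move=> /same_blockP ij /same_blockP jk; apply/same_blockP => l hl.
case: (boolP (minn i j <= l < maxn i j)%N) => [/ij //|h].
by apply: jk; lia.
Qed.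

Definition block A i : {set 'I_n} := [set j | same_block A i j].

Lemma block_eq A i j : same_block A i j -> block A i = block A j.
Proof.
move=> ij; apply/finset.setP => k; rewrite !inE; apply/idP/idP => h.
  by apply: same_block_trans h; rewrite same_block_sym.
exact: same_block_trans h.
Qed.

Lemma card_block_gt0 A i : (0 < #|block A i|)%N.
Proof. by rewrite card_gt0; apply/finset.set0Pn; exists i; rewrite inE same_block_refl. Qed.

(** If [i] is the first index where the partitions differ, then the two blocks of
    [i] start at the same place but one of them ends at [i]. *)
Lemma card_block_neq A A' i j : j = i.+1 :> nat -> i \in A -> i \notin A' ->
  (forall k, (k < i)%N -> (k \in A) = (k \in A')) ->
  #|block A i| <> #|block A' i|.
Proof.
move=> ji iA iA' AA' /eqP; rewrite ltn_eqF//; apply: proper_card; apply/properP; split.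
  apply/fintype.subsetP => k; rewrite !inE => /same_blockP h; apply/same_blockP => l hl.
  have ki : (k <= i)%N.
    by rewrite leqNgt; apply/negP => ik; have /negP := h i ltac:(lia); apply.
  by rewrite -AA'; [apply: h|]; lia.
exists j; rewrite inE.
  apply/same_blockP => k hk; suff -> : k = i by [].
  by apply: val_inj => /=; lia.
by apply/negP => /same_blockP /(_ i ltac:(lia)) /negP; apply.
Qed.

End partitions.

Section block_means.
Context (R : realType) (n : nat).
Implicit Types (A : {set 'I_n}) (Y u v : 'rV[R]_n).

Definition rss u Y : R := \sum_i (u 0 i - Y 0 i) ^+ 2.

Definition block_mean A Y : 'rV[R]_n :=
  \row_i (#|block A i|%:R^-1 * \sum_(j in block A i) Y 0 j).

(** The squared norm of the projection of [Y] onto the vectors that are constant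
    on the blocks, written out as a quadratic form. *)
Definition block_energy A Y : R :=
  \sum_i \sum_j (if same_block A i j then #|block A i|%:R^-1 else 0) * Y 0 i * Y 0 j.

Definition block_constant A u := forall i j, same_block A i j -> u 0 i = u 0 j.

Lemma block_mean_constant A Y : block_constant A (block_mean A Y).
Proof. by move=> i j ij; rewrite !mxE (block_eq ij). Qed.

(** The block means are an orthogonal projection. *)
Lemma block_mean_adjoint A Y c : block_constant A c ->
  \sum_i c 0 i * block_mean A Y 0 i = \sum_i c 0 i * Y 0 i.
Proof.
move=> hc.
transitivity (\sum_i \sum_(j in block A i) c 0 j * #|block A j|%:R^-1 * Y 0 j).
  apply: eq_bigr => i _; rewrite mxE mulrA mulr_sumr; apply: eq_bigr => j.
  by rewrite inE => ij; rewrite (hc _ _ ij) (block_eq ij).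
rewrite (exchange_big_dep predT)//=; apply: eq_bigr => j _.
rewrite (eq_bigl (mem (block A j))); last by move=> i; rewrite !inE same_block_sym.
rewrite sumr_const -mulr_natr; field.
by rewrite pnatr_eq0 -lt0n card_block_gt0.
Qed.

Lemma block_energyE A Y : block_energy A Y = \sum_i Y 0 i * block_mean A Y 0 i.
Proof.
apply: eq_bigr => i _; rewrite mxE mulrA mulr_sumr.
rewrite [RHS]big_mkcond; apply: eq_bigr => j _; rewrite inE.
case: ifP => _; last by rewrite !mul0r.
by rewrite [_ ^-1 * _]mulrC.
Qed.

Lemma rss_block_mean A Y : rss (block_mean A Y) Y = rss 0 Y - block_energy A Y.
Proof.
rewrite block_energyE.
have h := block_mean_adjoint Y (block_mean_constant (A := A) Y).
move: (block_mean A Y) h => v h.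
have : rss v Y - (rss 0 Y - \sum_i Y 0 i * v 0 i) =
    \sum_i v 0 i * v 0 i - \sum_i v 0 i * Y 0 i.
  rewrite /rss -!sumrB; apply: eq_bigr => i _.
  by rewrite [(0 : 'rV_n) 0 i]mxE; ring.
by rewrite h subrr => /eqP; rewrite subr_eq0 => /eqP.
Qed.

Lemma rss_pythagoras A Y u : block_constant A u ->
  rss u Y = rss (block_mean A Y) Y + rss u (block_mean A Y).
Proof.
move=> hu; set v := block_mean A Y.
have h1 : \sum_i v 0 i * v 0 i = \sum_i v 0 i * Y 0 i.
  exact/block_mean_adjoint/block_mean_constant.
have h2 : \sum_i u 0 i * v 0 i = \sum_i u 0 i * Y 0 i by exact: block_mean_adjoint.
have : rss u Y - (rss v Y + rss u v) =
  2 * (\sum_i u 0 i * v 0 i - \sum_i u 0 i * Y 0 i) +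
  2 * (\sum_i v 0 i * Y 0 i - \sum_i v 0 i * v 0 i).
  rewrite /rss -big_split -!sumrB !mulr_sumr -big_split/=.
  by apply: eq_bigr => i _; ring.
by rewrite h1 h2 !subrr !mulr0 addr0 => /eqP; rewrite subr_eq0 => /eqP.
Qed.

Lemma rss_eq0 u v : rss u v <= 0 -> u = v.
Proof.
move=> h; apply/rowP => i; apply/eqP; rewrite -subr_eq0 -sqrf_eq0.
have := h; rewrite /rss (bigD1 i)//= => {}h.
have h0 : 0 <= \sum_(j | j != i) (u 0 j - v 0 j) ^+ 2 by apply: sumr_ge0 => j _; exact: sqr_ge0.
by rewrite eq_le sqr_ge0 andbT; lra.
Qed.

Definition cuts u : {set 'I_n} :=
  [set i : 'I_n | [exists j : 'I_n, (j == i.+1 :> nat) && (u 0 i != u 0 j)]].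

Lemma njumpsE u : njumps u = #|cuts u|.
Proof.
rewrite /njumps -(card_in_imset (f := fun p : 'I_n * 'I_n => p.1)); last first.
  move=> [i j] [i' j']; rewrite !unfold_in /= => /andP[/eqP h _] /andP[/eqP h' _] ii'.
  by rewrite -ii' in h' *; congr pair; apply: val_inj; rewrite /= h h'.
apply: eq_card => i; apply/imsetP/idP.
  move=> [[k j]]; rewrite unfold_in /= => h ->; rewrite inE; apply/existsP; by exists j.
by rewrite inE => /existsP[j hj]; exists (i, j).
Qed.

Lemma cuts_constant u : block_constant (cuts u) u.
Proof.
suff h (i j : 'I_n) : (i <= j)%N -> same_block (cuts u) i j -> u 0 i = u 0 j.
  move=> i j ij; have [|/ltnW] := leqP i j; first by move=> le; apply: h.
  by move=> ji; apply/esym/h => //; rewrite same_block_sym.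
move: j => [j jn] /=; elim: j jn => [|j IH] jn ij /same_blockP hij.
  by congr (u 0 _); apply: val_inj => /=; lia.
move: ij; rewrite leq_eqVlt => /orP[/eqP ij|ij].
  by congr (u 0 _); apply: val_inj.
have jn' : (j < n)%N by lia.
have := hij (Ordinal jn') ltac:(rewrite /=; lia).
rewrite inE negb_exists => /forallP /(_ (Ordinal jn)); rewrite /= eqxx/= negbK => /eqP <-.
apply: IH => //; apply/same_blockP => k hk; apply: hij; move: hk => /=; lia.
Qed.

Lemma cuts_block_constant A u : block_constant A u -> cuts u \subset A.
Proof.
move=> hu; apply/fintype.subsetP => i; rewrite inE => /existsP[j /andP[/eqP ji]].
apply: contraR => iA; apply/eqP/hu/same_blockP => k hk.
by rewrite (_ : k = i)//; apply: val_inj => /=; lia.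
Qed.

Lemma cuts_lt u i : i \in cuts u -> (i.+1 < n)%N.
Proof. by rewrite inE => /existsP[j /andP[/eqP <- _]]. Qed.

(** Averaging [Y] over the runs of [u] creates no jump and can only decrease the
    residual sum of squares. *)
Lemma least_squares_block_mean Y u :
  (forall v, (njumps v <= njumps u)%N -> rss u Y <= rss v Y) ->
  u = block_mean (cuts u) Y.
Proof.
move=> hu; apply: rss_eq0.
have hp := rss_pythagoras Y (@cuts_constant u).
have : rss u Y <= rss (block_mean (cuts u) Y) Y.
  apply: hu; rewrite !njumpsE; apply/subset_leq_card/cuts_block_constant.
  exact: block_mean_constant.
lra.
Qed.

(** The last index is never a cut, and adding it to [A] does not change the
    partition. *)
Definition energies_differ Y := forall A A' : {set 'I_n},
  (forall i, i \in A -> (i.+1 < n)%N) -> (forall i, i \in A' -> (i.+1 < n)%N) ->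
  A != A' -> block_energy A Y != block_energy A' Y.

Lemma least_squares_unique Y u u' : energies_differ Y -> njumps u = njumps u' ->
  (forall v, (njumps v <= njumps u)%N -> rss u Y <= rss v Y) ->
  (forall v, (njumps v <= njumps u')%N -> rss u' Y <= rss v Y) ->
  u = u'.
Proof.
move=> hY uu' hu hu'.
have Eu := least_squares_block_mean hu; have Eu' := least_squares_block_mean hu'.
have E : block_energy (cuts u) Y = block_energy (cuts u') Y.
  have h1 := rss_block_mean (cuts u) Y; have h2 := rss_block_mean (cuts u') Y.
  have h3 := hu u' ltac:(by rewrite uu'); have h4 := hu' u ltac:(by rewrite uu').
  by rewrite -Eu in h1; rewrite -Eu' in h2; lra.
have [cc|/(hY _ _ (@cuts_lt u) (@cuts_lt u'))] := eqVneq (cuts u) (cuts u').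
  by rewrite Eu Eu' cc.
by rewrite E eqxx.
Qed.

(** The block lengths are the inverses of the diagonal coefficients of the
    quadratic form [block_energy], so different partitions have different
    diagonals. *)
Lemma first_difference A A' :
  (forall i, i \in A -> (i.+1 < n)%N) -> (forall i, i \in A' -> (i.+1 < n)%N) ->
  A != A' -> exists i, #|block A i| <> #|block A' i|.
Proof.
move=> hA hA' AA'.
have [i0 hi0] : exists i, (i \in A) != (i \in A').
  apply/existsP; apply: contraR AA'; rewrite negb_exists => /forallP h.
  by apply/eqP/finset.setP => i; have := h i; rewrite negbK => /eqP.
case: (@arg_minnP _ i0 (fun i => (i \in A) != (i \in A')) val hi0) => i hi imin.
have below (k : 'I_n) : (k < i)%N -> (k \in A) = (k \in A').
  by move=> ki; apply/eqP; apply: contraLR ki => /imin; rewrite -leqNgt.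
exists i; have : (i.+1 < n)%N.
  by case: (boolP (i \in A)) hi => [/hA //|_]; case: (boolP (i \in A')) => [/hA' //|].
move=> h1; case: (boolP (i \in A)) hi => iA; case: (boolP (i \in A')) => // iA' _.
  exact: (@card_block_neq _ A A' i (Ordinal h1)).
by apply: nesym; apply: (@card_block_neq _ A' A i (Ordinal h1)) => // k /below.
Qed.

End block_means.

Section no_ties.
Context d (T : measurableType d) (R : realType) (P : probability T R).
Context (sigma : R).

(** Because [M i i] is not zero, the form is a polynomial of degree two in [X i]
    whose other coefficients depend on the other variables only. *)
Lemma quadratic_form_null (n : nat) (X : 'I_n -> {RV P >-> R}) (m : 'I_n -> R)
    (M : 'I_n -> 'I_n -> R) (i : 'I_n) :
  mutually_independent X -> (forall j, has_normal_law 0 sigma (X j)) ->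
  M i i != 0 ->
  P [set w | \sum_k \sum_l M k l * (m k + X k w) * (m l + X l w) = 0] = 0%E.
Proof.
move=> indep normal Mii.
pose Y k w := m k + X k w.
pose r w := \sum_(k | k != i) \sum_(l | l != i) M k l * Y k w * Y l w.
pose s w := \sum_(l | l != i) (M i l + M l i) * Y l w.
pose b w := 2 * M i i * m i + s w.
pose c w := M i i * m i ^+ 2 + m i * s w + r w.
have mY k : k != i -> @measurable_fun _ _ (sigma_off X i) R [set: sigma_off X i] (Y k).
  by move=> ki; apply: measurable_funD => //; exact: measurable_other.
have ms : @measurable_fun _ _ (sigma_off X i) R [set: sigma_off X i] s.
  rewrite /s; under eq_fun do rewrite -big_filter.
  apply: measurable_sum_in => l; rewrite mem_filter => /andP[li _].
  by apply: measurable_funM => //; exact: mY.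
have mr : @measurable_fun _ _ (sigma_off X i) R [set: sigma_off X i] r.
  rewrite /r; under eq_fun do rewrite -big_filter.
  apply: measurable_sum_in => k; rewrite mem_filter => /andP[ki _].
  under eq_fun do rewrite -big_filter.
  apply: measurable_sum_in => l; rewrite mem_filter => /andP[li _].
  by apply: measurable_funM; [apply: measurable_funM => //|]; exact: mY.
have mb : @measurable_fun _ _ (sigma_off X i) R [set: sigma_off X i] b.
  exact: measurable_funD.
have mc : @measurable_fun _ _ (sigma_off X i) R [set: sigma_off X i] c.
  apply: measurable_funD => //; apply: measurable_funD => //.
  exact: measurable_funM.
rewrite -(quadratic_null indep normal Mii mb mc); congr (P _).
apply: eq_set => w; congr (_ = _).
rewrite (bigD1 i)//= (bigD1 i)//=.
under [X in _ + X]eq_bigr => k ki do rewrite (bigD1 i)//=.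
rewrite big_split/= -/(r w) /b /c.
have -> : s w = \sum_(l | l != i) M i l * Y l w + \sum_(l | l != i) M l i * Y l w.
  by rewrite -big_split; apply: eq_bigr => l _; rewrite mulrDl.
have -> : \sum_(l | l != i) M i l * (m i + X i w) * (m l + X l w) =
    (m i + X i w) * \sum_(l | l != i) M i l * Y l w.
  by rewrite mulr_sumr; apply: eq_bigr => l _; rewrite /Y; ring.
have -> : \sum_(l | l != i) M l i * (m l + X l w) * (m i + X i w) =
    (m i + X i w) * \sum_(l | l != i) M l i * Y l w.
  by rewrite mulr_sumr; apply: eq_bigr => l _; rewrite /Y; ring.
ring.
Qed.

Lemma no_ties_whp (xi : forall n, 'I_n -> {RV P >-> R}) (m : forall n, 'I_n -> R) :
  (forall n (i : 'I_n), has_normal_law 0 sigma (xi n i)) ->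
  (forall n, mutually_independent (xi n)) ->
  whp P (fun n => [set w | energies_differ (\row_i (m n i + xi n i w))]).
Proof.
move=> normal indep e e0; near=> n.
pose ok (A : {set 'I_n}) := [forall i in A, (i.+1 < n)%N].
have okP (A : {set 'I_n}) : ok A -> forall i, i \in A -> (i.+1 < n)%N.
  by move=> /forall_inP.
pose Q (AA : {set 'I_n} * {set 'I_n}) := [&& ok AA.1, ok AA.2 & AA.1 != AA.2].
pose tie (AA : {set 'I_n} * {set 'I_n}) : set T :=
  [set w | block_energy AA.1 (\row_i (m n i + xi n i w)) =
           block_energy AA.2 (\row_i (m n i + xi n i w))].
pose M (AA : {set 'I_n} * {set 'I_n}) (k l : 'I_n) : R :=
  (if same_block AA.1 k l then #|block AA.1 k|%:R^-1 else 0) -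
  (if same_block AA.2 k l then #|block AA.2 k|%:R^-1 else 0).
have tieE AA : tie AA =
    [set w | \sum_k \sum_l M AA k l * (m n k + xi n k w) * (m n l + xi n l w) = 0].
  apply: eq_set => w; apply/propext.
  rewrite (rwP eqP) -subr_eq0 -(rwP eqP).
  rewrite (_ : _ - _ = \sum_k \sum_l M AA k l * (m n k + xi n k w) * (m n l + xi n l w))//.
  rewrite /block_energy -sumrB; apply: eq_bigr => k _; rewrite -sumrB.
  by apply: eq_bigr => l _; rewrite !mxE /M; ring.
have mtie AA : measurable (tie AA).
  rewrite tieE.
  have h : measurable_fun [set: T]
      (fun w => \sum_k \sum_l M AA k l * (m n k + xi n k w) * (m n l + xi n l w)).
    apply: measurable_sum => k; apply: measurable_sum => l.
    apply: measurable_funM; last exact: measurable_funD.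
    by apply: measurable_funM => //; exact: measurable_funD.
  by have := h measurableT [set 0] (measurable_set1 0); rewrite setTI.
have tie0 AA : Q AA -> P (tie AA) = 0%E.
  move=> /and3P[h1 h2 h12]; rewrite tieE.
  have [i hi] := first_difference (okP _ h1) (okP _ h2) h12.
  apply: (@quadratic_form_null _ _ _ _ i (indep n) (normal n)).
  rewrite /M !same_block_refl subr_eq0; apply/negP => /eqP /invr_inj /eqP.
  by rewrite eqr_nat => /eqP.
exists (\big[setU/set0]_(AA in [pred AA | Q AA]) tie AA); split.
- by apply: bigsetU_measurable.
- move=> w /= nd; apply: contrapT => nT; apply: nd => A A' hA hA' AA'.
  apply/eqP => E; apply: nT; rewrite -bigcup_pred; exists (A, A') => //=.
  by rewrite inE /= /Q /= AA' !andbT; apply/andP; split; apply/forall_inP.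
- suff [_ ->] : measurable (\big[setU/set0]_(AA in [pred AA | Q AA]) tie AA) /\
      P (\big[setU/set0]_(AA in [pred AA | Q AA]) tie AA) = 0%E.
    by rewrite lee_fin ltW.
  elim/big_ind : _ => [|A B [mA A0] [mB B0]|AA /tie0 //]; first by rewrite measure0.
  split; first exact: measurableU.
  apply/eqP; rewrite eq_le measure_ge0 andbT -[leRHS]adde0.
  rewrite -[X in (_ <= X + _)%E]A0 -[X in (_ <= _ + X)%E]B0.
  exact: measureU2.
Unshelve. all: by end_near. Qed.

End no_ties.

(** * Piecewise constant sequences *)

Section jump_counts.
Context (R : realType).
Implicit Types (u w z : nat -> R) (a b c : nat).

(** The link from [b.-1] to [b] is counted, which makes the count additive in the
    interval. *)
Definition jumps u a b : nat := \sum_(a <= i < b) (u i != u i.+1).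

Lemma jumps_cat u a b c : (a <= b <= c)%N ->
  jumps u a c = (jumps u a b + jumps u b c)%N.
Proof. by move=> /andP[ab bc]; rewrite /jumps (@big_cat_nat _ _ _ b). Qed.

Lemma jumps0 u a b : jumps u a b = 0%N -> forall i, (a <= i <= b)%N -> u i = u a.
Proof.
move=> h; elim=> [|i IH] /andP[ai ib]; first by congr u; lia.
move: ai; rewrite leq_eqVlt => /orP[/eqP <- //|ai].
rewrite -IH; last lia.
have : (jumps u i i.+1 <= jumps u a b)%N.
  rewrite (@jumps_cat u a i.+1 b); last lia.
  by rewrite (@jumps_cat u a i i.+1) -?addnA ?leq_addr//; lia.
by rewrite h /jumps big_nat1 leqn0 eqb0 negbK => /eqP.
Qed.

Lemma first_jump u a b : (0 < jumps u a b)%N -> exists i,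
  [/\ (a <= i < b)%N, jumps u a i = 0%N & jumps u i i.+1 = 1%N].
Proof.
elim: b => [|b IH]; first by rewrite /jumps big_geq.
have [ba|ab] := ltnP b a; first by rewrite /jumps big_geq//; lia.
rewrite (@jumps_cat u a b b.+1); last lia.
have [j0|/IH[i [hi h1 h2]] _] := posnP (jumps u a b).
  rewrite j0 add0n => h; exists b; split => //; first lia.
  by move: h; rewrite /jumps big_nat1; case: (_ != _).
by exists i; split => //; lia.
Qed.

Lemma jumps_sub_le u v a b :
  (jumps (fun i => (u i - v i)%R) a b <= jumps u a b + jumps v a b)%N.
Proof.
rewrite /jumps -big_split/=; apply: leq_sum => i _.
have [ui|_] := eqVneq (u i) (u i.+1); last first.
  by apply: leq_trans (leq_b1 _) _; rewrite leq_addr.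
have [vi|_] := eqVneq (v i) (v i.+1); first by rewrite ui vi eqxx.
exact: leq_b1.
Qed.

End jump_counts.

Section segment_bound.
Context (R : realType).
Implicit Types (u w z : nat -> R) (a b c : nat) (B : R).

Definition sum_le B z a b := (\sum_(a <= i < b) z i) ^+ 2 <= B * (b - a)%:R.

(** Completing the square: for [l] indices, [- 2 x Z - l x ^ 2 / 2] is at most
    [2 Z ^ 2 / l]. *)
Lemma segment_bound1 B z w a b (x : R) : 0 <= B -> (a <= b)%N -> sum_le B z a b ->
  (forall i, (a <= i < b)%N -> w i = x) ->
  \sum_(a <= i < b) (- 2 * (z i * w i) - w i ^+ 2 / 2) <= 2 * B.
Proof.
move=> B0 ab hz hw; rewrite /sum_le in hz.
have -> : \sum_(a <= i < b) (- 2 * (z i * w i) - w i ^+ 2 / 2) =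
    - 2 * x * (\sum_(a <= i < b) z i) - (b - a)%:R * (x ^+ 2 / 2).
  rewrite sumrB mulr_sumr; congr (_ - _).
    by apply: eq_big_nat => i hi; rewrite hw//; ring.
  under eq_big_nat => i hi do rewrite hw//.
  by rewrite sumr_const_nat mulr_natl.
move: hz; move: (\sum_(a <= i < b) z i) => Z.
have [->|] := posnP (b - a)%N; first by rewrite mulr0 mul0r => h; nra.
rewrite -(ltr0n R); move: ((b - a)%:R) => l l0 hz.
rewrite -(ler_pM2l l0).
have := sqr_ge0 (l * x + 2 * Z); nra.
Qed.

Lemma segment_bound B z w a b : 0 <= B -> (a <= b)%N ->
  (forall c d, (a <= c <= d)%N -> (d <= b)%N -> sum_le B z c d) ->
  \sum_(a <= i < b) (- 2 * (z i * w i) - w i ^+ 2 / 2) <=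
    2 * B * (jumps w a b).+1%:R.
Proof.
move=> B0; move jE : (jumps w a b) => j.
elim: j a jE => [|j IH] a jE ab hz.
  rewrite mulr1; apply: (@segment_bound1 _ _ _ _ _ (w a)) => //.
    by apply: hz; lia.
  by move=> i hi; apply: (jumps0 jE); lia.
have [i [hi h0 h1]] : exists i, [/\ (a <= i < b)%N, jumps w a i = 0%N & jumps w i i.+1 = 1%N].
  by apply: first_jump; rewrite jE.
rewrite (@big_cat_nat _ _ _ i.+1)/=; [|lia|lia].
rewrite -(natr1 j.+1) mulrDr mulr1 addrC; apply: lerD.
  apply: IH; [|lia|by move=> c d hc hd; apply: hz; lia].
  have := @jumps_cat _ w a i.+1 b; have := @jumps_cat _ w a i i.+1; lia.
apply: (@segment_bound1 _ _ _ _ _ (w a)) => //; first lia.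
  by apply: hz; lia.
by move=> k hk; apply: (jumps0 h0); lia.
Qed.

(** Here only intervals that share an end with [[a, b)] are involved. *)
Lemma one_jump_bound B z w a b : 0 <= B -> (a <= b)%N -> (jumps w a b <= 1)%N ->
  (forall c, (a <= c <= b)%N -> sum_le B z a c /\ sum_le B z c b) ->
  \sum_(a <= i < b) (- 2 * (z i * w i) - w i ^+ 2 / 2) <= 4 * B.
Proof.
move=> B0 ab j1 hz.
have [j0|/first_jump[i [hi h0 h1]]] := posnP (jumps w a b).
  apply: (@le_trans _ _ (2 * B)); last lra.
  apply: (@segment_bound1 _ _ _ _ _ (w a)) => //.
    by have [] := hz b ltac:(lia).
  by move=> i hi; apply: (jumps0 j0); lia.
have [hz1 hz2] := hz i.+1 ltac:(lia).
rewrite (@big_cat_nat _ _ _ i.+1)/=; [|lia|lia].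
rewrite (_ : 4 * B = 2 * B + 2 * B); last ring.
apply: lerD; [apply: (@segment_bound1 _ _ _ _ _ (w a))|
  apply: (@segment_bound1 _ _ _ _ _ (w i.+1))] => //; try lia.
  by move=> k hk; apply: (jumps0 h0); lia.
have j0 : jumps w i.+1 b = 0%N.
  have := @jumps_cat _ w a i.+1 b; have := @jumps_cat _ w a i i.+1; lia.
by move=> k hk; apply: (jumps0 j0); lia.
Qed.

End segment_bound.

Section row_extension.
Context (R : realType) (n : nat).
Implicit Types (u v Y : 'rV[R]_n.+1).

(** Repeating the last entry past the end matches the left limit of a step function
    at [1], and creates no jump. *)
Definition ext u (i : nat) : R := u 0 (inord (minn i n)).

Lemma extE u (i : 'I_n.+1) : ext u i = u 0 i.
Proof.
rewrite /ext (minn_idPl _); last by rewrite -ltnS ltn_ord.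
by rewrite inord_val.
Qed.

Lemma ext_row (g : nat -> R) i : (i < n.+1)%N -> ext (\row_(j < n.+1) g j) i = g i.
Proof. by move=> hi; rewrite -[i]/(val (Ordinal hi)) extE mxE. Qed.

Lemma ext_last u i : (n <= i)%N -> ext u i = ext u n.
Proof. by move=> ni; rewrite /ext (minn_idPr ni) minnn. Qed.

Lemma njumps_ext u : njumps u = jumps (ext u) 0 n.+1.
Proof.
rewrite njumpsE /jumps big_mkord -sum1_card big_mkcond/=.
apply: eq_bigr => i _; rewrite inE; case: existsP => [[j /andP[/eqP ji]]|h].
  by rewrite -ji !extE => ->.
case: (ltnP i n) => hi; last first.
  by rewrite (ext_last _ hi) ext_last ?eqxx//; lia.
have hi' : (i.+1 < n.+1)%N by [].
case: eqP => // /eqP hne; case: h; exists (Ordinal hi'); rewrite /= eqxx/=.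
by move: hne; rewrite extE -[i.+1]/(val (Ordinal hi')) extE.
Qed.

Lemma rss_ext u Y : rss u Y = \sum_(0 <= i < n.+1) (ext u i - ext Y i) ^+ 2.
Proof. by rewrite big_mkord; apply: eq_bigr => i _; rewrite !extE. Qed.

End row_extension.

(** * Minimizers of the Potts functional *)

Section potts_argmin.
Context (R : realType) (n : nat).
Implicit Types (u v Y : 'rV[R]_n.+1).

Lemma pottsE g u Y : potts g%:E u Y = (n.+1%:R^-1 * rss u Y + g * (njumps u)%:R)%:E.
Proof. by []. Qed.

Lemma argmin_potts_rss (g : R) Y u v : argmin_potts g%:E Y u ->
  rss u Y + n.+1%:R * g * (njumps u)%:R <= rss v Y + n.+1%:R * g * (njumps v)%:R.
Proof.
move=> /(_ v); rewrite !pottsE lee_fin.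
have N0 : 0 < n.+1%:R :> R by rewrite ltr0n.
rewrite -(ler_pM2l N0) !mulrDr !mulrA mulfV ?gt_eqF// !mul1r.
by [].
Qed.

Lemma argmin_potts_oo Y u : argmin_potts +oo%E Y u -> njumps u = 0%N.
Proof.
move=> /(_ 0); rewrite /potts.
have -> : njumps (0 : 'rV[R]_n.+1) = 0%N.
  by rewrite /njumps; apply: eq_card0 => -[i j]; rewrite unfold_in /= !mxE eqxx andbF.
rewrite mule0 adde0; have [//|j0] := posnP (njumps u).
rewrite mulyr gtr0_sg ?ltr0n// mul1e addey//.
Qed.

(** This covers the infinite penalty, for which a minimizer is constant. *)
Lemma argmin_potts_least_squares (g : \bar R) Y u v : (0 <= g)%E ->
  argmin_potts g Y u -> (njumps v <= njumps u)%N -> rss u Y <= rss v Y.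
Proof.
case: g => [g| |]// g0 hu vu.
  have := argmin_potts_rss v hu.
  have N0 : 0 <= n.+1%:R :> R by [].
  rewrite lee_fin in g0; move: vu; rewrite -(ler_nat R) => vu.
  have := ler_wpM2l (mulr_ge0 N0 g0) vu; lra.
have u0 := argmin_potts_oo hu.
have v0 : njumps v = 0%N by move: vu; rewrite u0 leqn0 => /eqP.
have := hu v; rewrite /potts u0 v0 mule0 !adde0 lee_fin ler_pM2l ?invr_gt0 ?ltr0n//.
Qed.

End potts_argmin.

(** * Distance of a fit to the signal *)

Lemma subinterval_sum_le (R : realType) (F : nat -> R) a b c d : (forall i, 0 <= F i) ->
  (a <= c <= d)%N -> (d <= b)%N ->
  \sum_(c <= i < d) F i <= \sum_(a <= i < b) F i.
Proof.
move=> F0 /andP[ac cd] db.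
rewrite (@big_cat_nat _ _ _ c a b)/=; [|lia|lia].
rewrite (@big_cat_nat _ _ _ d c b)/=; [|lia|lia].
have h1 : 0 <= \sum_(a <= i < c) F i by apply: sumr_ge0.
have h2 : 0 <= \sum_(d <= i < b) F i by apply: sumr_ge0.
lra.
Qed.

Section residuals.
Context (R : realType) (n : nat) (Y : 'rV[R]_n.+1) (fs z : nat -> R).
Hypothesis Y_split : forall i, (i < n.+1)%N -> ext Y i = fs i + z i.

Definition signal_row : 'rV[R]_n.+1 := \row_(i < n.+1) fs i.

Definition misfit (u : 'rV[R]_n.+1) : R := \sum_(0 <= i < n.+1) (fs i - ext u i) ^+ 2.

Lemma misfit_ge0 u : 0 <= misfit u.
Proof. by apply: sumr_ge0 => i _; exact: sqr_ge0. Qed.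

(** The basic identity, with half of the squared distance moved to the left: the
    right-hand side is bounded run by run. *)
Lemma rss_signal_row u :
  rss signal_row Y - rss u Y + misfit u / 2 =
  \sum_(0 <= i < n.+1) (- 2 * (z i * (fs i - ext u i)) - (fs i - ext u i) ^+ 2 / 2).
Proof.
rewrite !rss_ext /misfit mulr_suml -sumrB -big_split/=; apply: eq_big_nat => i hi.
by rewrite ext_row// Y_split//; field.
Qed.

(** The residual is [z i + (fs i - u i) + (u i - u i.+1)]. The second term is
    controlled by Cauchy-Schwarz and the third one telescopes. *)
Lemma interval_residual_le (C S : R) (u : 'rV[R]_n.+1) a b : (a < b <= n.+1)%N ->
  (forall i, (i < n.+1)%N -> `|fs i| <= C) ->
  `|\sum_(a <= i < b) z i| <= S ->
  `|\sum_(a <= i < b) (ext Y i - ext u i.+1)| <=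
     S + 2 * C + 3 * Num.sqrt (misfit u) * Num.sqrt (b - a)%:R.
Proof.
move=> /andP[ab bn] hC hS.
have wi i : (i < n.+1)%N -> `|fs i - ext u i| <= Num.sqrt (misfit u).
  move=> hi; rewrite -sqrtr_sqr ler_wsqrtr//.
  have := @subinterval_sum_le R (fun i => (fs i - ext u i) ^+ 2) 0 n.+1 i i.+1
    (fun i => sqr_ge0 _) ltac:(lia) ltac:(lia).
  by rewrite big_nat1.
have ui i : (i <= n.+1)%N -> `|ext u i| <= C + Num.sqrt (misfit u).
  wlog hi : i / (i < n.+1)%N.
    move=> h ii; have [/h -> //|ni] := ltnP i n.+1.
    by rewrite ext_last; [apply: h|lia].
  move=> _; have := ler_normB (fs i) (fs i - ext u i); rewrite opprB addrC subrK.
  have := wi i hi; have := hC i hi; lra.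
have -> : \sum_(a <= i < b) (ext Y i - ext u i.+1) =
    \sum_(a <= i < b) z i + \sum_(a <= i < b) (fs i - ext u i) + (ext u a - ext u b).
  rewrite -[X in _ = _ + X]opprB -telescope_sumr; last lia.
  rewrite -sumrN -!big_split/=; apply: eq_big_nat => i hi.
  by rewrite Y_split; [ring|lia].
have l1 : 1 <= Num.sqrt ((b - a)%:R : R).
  by rewrite -[leLHS]sqrtr1 ler_wsqrtr// ler1n subn_gt0.
have hW : `|\sum_(a <= i < b) (fs i - ext u i)| <=
    Num.sqrt (misfit u) * Num.sqrt (b - a)%:R.
  have l0 : 0 < (b - a)%:R :> R by rewrite ltr0n subn_gt0.
  rewrite -sqrtrM ?misfit_ge0// -sqrtr_sqr ler_wsqrtr//.
  set W := \sum_(a <= i < b) _.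
  have hM : \sum_(a <= i < b) (fs i - ext u i) ^+ 2 <= misfit u.
    by apply: subinterval_sum_le => [i||]; [exact: sqr_ge0|lia|lia].
  have : 0 <= \sum_(a <= i < b) ((b - a)%:R * (fs i - ext u i) - W) ^+ 2.
    by apply: sumr_ge0 => i _; exact: sqr_ge0.
  have -> : \sum_(a <= i < b) ((b - a)%:R * (fs i - ext u i) - W) ^+ 2 =
     (b - a)%:R * ((b - a)%:R * (\sum_(a <= i < b) (fs i - ext u i) ^+ 2) - W ^+ 2).
    transitivity (\sum_(a <= i < b) ((b - a)%:R ^+ 2 * (fs i - ext u i) ^+ 2 -
      2 * (b - a)%:R * W * (fs i - ext u i) + W ^+ 2)).
      by apply: eq_bigr => i _; ring.
    rewrite big_split sumrB -!mulr_sumr/= sumr_const_nat -/W -mulr_natl; ring.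
  rewrite pmulr_rge0// subr_ge0 => /le_trans; apply.
  by rewrite mulrC ler_wpM2r// ltW.
have := ler_normD (\sum_(a <= i < b) z i + \sum_(a <= i < b) (fs i - ext u i))
  (ext u a - ext u b).
have := ler_normD (\sum_(a <= i < b) z i) (\sum_(a <= i < b) (fs i - ext u i)).
have := ler_normB (ext u a) (ext u b).
have := ui a ltac:(lia); have := ui b ltac:(lia).
have h := ler_wpM2l (sqrtr_ge0 (misfit u)) l1.
move: h; rewrite mulr1; lra.
Qed.

End residuals.

(** A signal with jumps at the indices [p k], each inside a window
    [[q k, q k.+1)]: the jumps have height at least [D], and lie at distance at
    least [rho * n] from the ends of their windows. *)
Record step_signal (R : realType) (n K : nat) (fs : nat -> R) (q p : nat -> nat)
    (lev : nat -> R) (D rho : R) : Prop := StepSignal {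
  signal_order : forall k, (k < K)%N -> (q k <= p k <= q k.+1)%N;
  signal_last_anchor : (q K <= n.+1)%N;
  signal_first : forall i, (i < q 0)%N -> fs i = lev 0%N;
  signal_left : forall k i, (k < K)%N -> (q k <= i < p k)%N -> fs i = lev k;
  signal_right : forall k i, (k < K)%N -> (p k <= i < q k.+1)%N -> fs i = lev k.+1;
  signal_last : forall i, (q K <= i < n.+1)%N -> fs i = lev K;
  signal_jumps : (jumps fs 0 n.+1 <= K)%N;
  signal_D_gt0 : 0 < D;
  signal_gap : forall k, (k < K)%N -> D <= `|lev k - lev k.+1|;
  signal_rho_gt0 : 0 < rho;
  signal_sep_left : forall k, (k < K)%N -> rho * n.+1%:R <= (p k - q k)%:R;
  signal_sep_right : forall k, (k < K)%N -> rho * n.+1%:R <= (q k.+1 - p k)%:R }.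

Section signal_windows.
Context (R : realType) (n K : nat) (fs : nat -> R).
Context (q p : nat -> nat) (lev : nat -> R) (D rho : R).
Hypothesis sg : step_signal n K fs q p lev D rho.

Let order := signal_order sg.
Let qK := signal_last_anchor sg.
Let fs_first := signal_first sg.
Let fs_left := signal_left sg.
Let fs_right := signal_right sg.
Let fs_last := signal_last sg.
Let fs_jumps := signal_jumps sg.
Let D_gt0 := signal_D_gt0 sg.
Let gap := signal_gap sg.
Let rho_gt0 := signal_rho_gt0 sg.
Let sep_left := signal_sep_left sg.
Let sep_right := signal_sep_right sg.
Let N0 : 0 < n.+1%:R :> R. Proof. by rewrite ltr0n. Qed.

Lemma njumps_signal_row : (njumps (signal_row n fs) <= K)%N.
Proof.
apply: leq_trans fs_jumps; rewrite njumps_ext /jumps !big_mkord; apply: leq_sum => i _.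
rewrite ext_row//; case: (ltnP i.+1 n.+1) => hi; first by rewrite ext_row.
rewrite ext_last; last by lia.
rewrite (_ : nat_of_ord i = n); last by have := ltn_ord i; lia.
by rewrite ext_row// eqxx.
Qed.

Lemma window_le k l : (k <= l <= K)%N -> (q k <= q l)%N.
Proof.
move=> /andP[kl]; elim: l kl => [|l IH]; first by rewrite leqn0 => /eqP ->.
rewrite leq_eqVlt => /orP[/eqP -> //|kl] lK.
by have := order lK; have := IH kl (ltnW lK); lia.
Qed.

Lemma anchor_le k : (k <= K)%N -> (q k <= n.+1)%N.
Proof. by move=> kK; apply: leq_trans qK; apply: window_le; rewrite kK leqnn. Qed.

Lemma jump_le k : (k < K)%N -> (p k <= n.+1)%N.
Proof. by move=> kK; case/andP: (order kK) => _ /leq_trans; apply; exact: anchor_le. Qed.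

Lemma windows_hit (v : nat -> R) :
  (forall k, (k < K)%N -> (0 < jumps v (q k) (q k.+1))%N) ->
  forall k l, (k <= l <= K)%N -> (l - k <= jumps v (q k) (q l))%N.
Proof.
move=> hv k l /andP[kl]; elim: l kl => [|l IH] kl lK; first by lia.
have [kl'|lk] := leqP k l; last by rewrite (_ : l.+1 - k = 0)%N; lia.
rewrite (@jumps_cat _ v (q k) (q l)); last by rewrite !window_le//; lia.
by have := IH kl' (ltnW lK); have := hv l lK; lia.
Qed.

Lemma windows_hit_njumps (u : 'rV[R]_n.+1) :
  (forall k, (k < K)%N -> (0 < jumps (ext u) (q k) (q k.+1))%N) -> (K <= njumps u)%N.
Proof.
move=> hit; have h := windows_hit hit (k := 0) (l := K) ltac:(lia).
have q0K := @window_le 0 K ltac:(lia).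
rewrite njumps_ext (@jumps_cat _ _ 0 (q 0)); last lia.
by rewrite (@jumps_cat _ _ (q 0) (q K)); lia.
Qed.

(** With [K] disjoint windows and [K] jumps there is no jump left outside. *)
Lemma windows_hit_once (v : nat -> R) :
  (forall k, (k < K)%N -> (0 < jumps v (q k) (q k.+1))%N) ->
  jumps v 0 n.+1 = K ->
  [/\ jumps v 0 (q 0) = 0%N, jumps v (q K) n.+1 = 0%N &
      forall k, (k < K)%N -> jumps v (q k) (q k.+1) = 1%N].
Proof.
move=> hv vK; have hit := windows_hit hv.
have E0 : jumps v 0 n.+1 = (jumps v 0 (q 0) + jumps v (q 0) (q K) + jumps v (q K) n.+1)%N.
  have h := @window_le 0 K ltac:(lia).
  rewrite (@jumps_cat _ v 0 (q 0)); last lia.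
  by rewrite (@jumps_cat _ v (q 0) (q K)) ?addnA//; lia.
have h0 := hit 0%N K ltac:(lia).
split; [lia|lia|move=> k kK].
have h1 := hit 0%N k ltac:(lia); have h2 := hit k.+1 K ltac:(lia).
have := hv k kK.
have := @jumps_cat _ v (q 0) (q k) (q K) ltac:(rewrite !window_le//; lia).
have := @jumps_cat _ v (q k) (q k.+1) (q K) ltac:(rewrite !window_le//; lia).
lia.
Qed.

Lemma sum_window_sep x y k : (k < K)%N -> D ^+ 2 / 2 <= (lev k - x) ^+ 2 + (lev k.+1 - x) ^+ 2 ->
  y = x -> rho * n.+1%:R * D ^+ 2 / 2 <=
    (p k - q k)%:R * (lev k - x) ^+ 2 + (q k.+1 - p k)%:R * (lev k.+1 - y) ^+ 2.
Proof.
move=> kK hD ->; have h1 := ler_wpM2r (sqr_ge0 (lev k - x)) (sep_left kK).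
have h2 := ler_wpM2r (sqr_ge0 (lev k.+1 - x)) (sep_right kK).
have h3 := ler_wpM2l (ltW (mulr_gt0 rho_gt0 N0)) hD; lra.
Qed.

Lemma gap_split k x : (k < K)%N -> D ^+ 2 / 2 <= (lev k - x) ^+ 2 + (lev k.+1 - x) ^+ 2.
Proof.
move=> kK; have h : D ^+ 2 <= (lev k - lev k.+1) ^+ 2.
  by rewrite -[leRHS]real_normK ?num_real// lerXn2r ?nnegrE ?(ltW D_gt0)// gap.
have := sqr_ge0 ((lev k - x) + (lev k.+1 - x)); lra.
Qed.

(** A constant cannot be close to both values that the signal takes in the
    window. *)
Lemma missed_window_misfit (u : 'rV[R]_n.+1) k : (k < K)%N ->
  jumps (ext u) (q k) (q k.+1) = 0%N ->
  rho * n.+1%:R * D ^+ 2 / 2 <= misfit fs u.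
Proof.
move=> kK /jumps0 hu.
have /andP[qp pq] := order kK.
have qN : (q k.+1 <= n.+1)%N by apply: leq_trans qK; apply: window_le; lia.
apply: (@le_trans _ _ (\sum_(q k <= i < q k.+1) (fs i - ext u i) ^+ 2)); last first.
  by apply: subinterval_sum_le => // [i|]; [exact: sqr_ge0|lia].
rewrite (@big_cat_nat _ _ _ (p k))//=.
rewrite (eq_big_nat _ _ (F2 := fun=> (lev k - ext u (q k)) ^+ 2)); last first.
  by move=> i hi; rewrite (fs_left kK hi) hu//; lia.
rewrite [X in _ <= _ + X](eq_big_nat _ _ (F2 := fun=> (lev k.+1 - ext u (q k)) ^+ 2)); last first.
  by move=> i hi; rewrite (fs_right kK hi) hu//; lia.
rewrite !sumr_const_nat -!(mulr_natl (_ ^+ 2)).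
by apply: sum_window_sep => //; exact: gap_split.
Qed.

End signal_windows.

Section potts_fit.
Context (R : realType) (n K : nat) (Y : 'rV[R]_n.+1) (fs z : nat -> R).
Context (q p : nat -> nat) (lev : nat -> R) (D rho B : R).
Hypothesis sg : step_signal n K fs q p lev D rho.
Hypothesis Y_split : forall i, (i < n.+1)%N -> ext Y i = fs i + z i.

Let order := signal_order sg.
Let qK := signal_last_anchor sg.
Let fs_first := signal_first sg.
Let fs_left := signal_left sg.
Let fs_right := signal_right sg.
Let fs_last := signal_last sg.
Let fs_jumps := signal_jumps sg.
Let D_gt0 := signal_D_gt0 sg.
Let gap := signal_gap sg.
Let rho_gt0 := signal_rho_gt0 sg.
Let sep_left := signal_sep_left sg.
Let sep_right := signal_sep_right sg.
Let N0 : 0 < n.+1%:R :> R. Proof. by rewrite ltr0n. Qed.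

(** The signal may jump on the link from [b.-1] to [b], which [jumps] counts.
    Replacing it by the constant [x] removes this jump and changes none of the
    terms. *)
Lemma anchored_piece (A x : R) (u : 'rV[R]_n.+1) a b : 0 <= A -> (a <= b)%N ->
  (forall i, (a <= i < b)%N -> fs i = x) -> (jumps (ext u) a b <= 1)%N ->
  (forall c, (a <= c <= b)%N -> sum_le A z a c /\ sum_le A z c b) ->
  \sum_(a <= i < b) (- 2 * (z i * (fs i - ext u i)) - (fs i - ext u i) ^+ 2 / 2) <= 4 * A.
Proof.
move=> A0 ab fx ju hz.
rewrite (eq_big_nat _ _ (F2 := fun i => - 2 * (z i * (x - ext u i)) - (x - ext u i) ^+ 2 / 2)).
  apply: (@one_jump_bound _ A z (fun i => x - ext u i)) => //.
  apply: leq_trans (jumps_sub_le (fun=> x) (ext u) a b) _.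
  by rewrite /jumps big1 ?add0n// => i _; rewrite eqxx.
by move=> i hi; rewrite fx.
Qed.

(** Between consecutive anchors the fit jumps at most once, so each run of
    [fs - u] has an anchor as an end and only the bound [A] for such intervals
    matters. Each of the [K] windows consists of two such pieces, and the two
    outer pieces contain no jump. *)
Lemma localized_misfit (A : R) (g : R) u : 0 <= A -> 0 <= g -> argmin_potts g%:E Y u ->
  njumps u = K ->
  (forall k, (k < K)%N -> (0 < jumps (ext u) (q k) (q k.+1))%N) ->
  (forall k b, (k <= K)%N -> (b <= n.+1)%N -> sum_le A z (q k) b /\ sum_le A z b (q k)) ->
  (forall k b, (k < K)%N -> (b <= n.+1)%N -> sum_le A z (p k) b /\ sum_le A z b (p k)) ->
  misfit fs u <= 16 * A * K.+1%:R.
Proof.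
move=> A0 g0 hu uK hit Aq Ap.
have ru : rss u Y <= rss (signal_row n fs) Y.
  by apply: (@argmin_potts_least_squares _ _ g%:E) => //; rewrite uK (njumps_signal_row sg).
have := rss_signal_row Y_split u.
have uK' := uK; rewrite njumps_ext in uK'.
have [j0 jK j1] := windows_hit_once sg hit uK'.
have q0_le k : (k <= K)%N -> (q 0 <= q k)%N by move=> kK; apply: (window_le sg).
have q_le := anchor_le sg.
have ends a b x : (a <= b)%N -> (forall i, (a <= i < b)%N -> fs i = x) ->
    jumps (ext u) a b = 0%N -> sum_le A z a b ->
    \sum_(a <= i < b) (- 2 * (z i * (fs i - ext u i)) - (fs i - ext u i) ^+ 2 / 2) <=
    2 * A.
  move=> ab fx ju hz.
  apply: (@segment_bound1 _ _ _ _ _ _ (x - ext u a)) => // i /andP[ai ib].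
  by rewrite fx ?ai// (jumps0 ju)// ai ltnW.
have middle k : (k <= K)%N ->
    \sum_(q 0 <= i < q k) (- 2 * (z i * (fs i - ext u i)) - (fs i - ext u i) ^+ 2 / 2) <=
    8 * A * k%:R.
  elim: k => [|k IH] kK; first by rewrite big_geq// mulr0.
  have /andP[qp pq] := order kK; have kK' := ltnW kK.
  have pN := jump_le sg kK; have qN := q_le _ kK.
  rewrite (@big_cat_nat _ _ _ (q k))/=; [|exact: q0_le|exact: leq_trans pq].
  rewrite -(natr1 k) mulrDr mulr1; apply: lerD; first exact: IH.
  rewrite (@big_cat_nat _ _ _ (p k))//=.
  have := j1 k kK; rewrite (@jumps_cat _ _ (q k) (p k)) ?qp// => jk.
  rewrite (_ : 8 * A = 4 * A + 4 * A); last by ring.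
  apply: lerD.
  - apply: (@anchored_piece A (lev k)) => //.
    + by move=> i; exact: fs_left.
    + by rewrite -jk leq_addr.
    move=> c /andP[_ cp]; have cN := leq_trans cp pN.
    by split; [have [] := Aq k c kK' cN|have [] := Ap k c kK cN].
  - apply: (@anchored_piece A (lev k.+1)) => //.
    + by move=> i; exact: fs_right.
    + by rewrite -jk leq_addl.
    move=> c /andP[_ cq]; have cN := leq_trans cq qN.
    by split; [have [] := Ap k c kK cN|have [] := Aq k.+1 c kK cN].
rewrite (@big_cat_nat _ _ _ (q 0))//=; last exact: q_le.
rewrite (@big_cat_nat _ _ _ (q K) (q 0))/=; [|exact: q0_le|exact: q_le].
have e1 := ends 0%N (q 0) (lev 0%N) (leq0n _) fs_first j0
  (proj2 (Aq 0%N 0%N (leq0n K) (leq0n _))).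
have e2 := ends (q K) n.+1 (lev K) (q_le K (leqnn K)) fs_last jK
  (proj1 (Aq K n.+1 (leqnn K) (leqnn _))).
have := middle K (leqnn K).
rewrite -(natr1 K); lra.
Qed.

Hypothesis B_ge0 : 0 <= B.
Hypothesis z_le : forall a b, (a <= b <= n.+1)%N -> sum_le B z a b.

Lemma rss_signal_row_le u :
  rss (signal_row n fs) Y - rss u Y + misfit fs u / 2 <= 2 * B * (K + njumps u).+1%:R.
Proof.
rewrite (rss_signal_row Y_split); 
apply: le_trans (@segment_bound _ B _ (fun i => fs i - ext u i) _ _ B_ge0 _ _) _ => //.
  by move=> c d cd dn; apply: z_le; lia.
apply: ler_wpM2l; first by rewrite mulr_ge0.
rewrite ler_nat ltnS njumps_ext.
exact: leq_trans (jumps_sub_le _ _ _ _) (leq_add fs_jumps (leqnn _)).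
Qed.

Lemma argmin_misfit_le (g : R) u : 0 <= g -> argmin_potts g%:E Y u ->
  misfit fs u / 2 + n.+1%:R * g * (njumps u)%:R <=
  2 * B * (K + njumps u).+1%:R + n.+1%:R * g * K%:R.
Proof.
move=> g0 hu; have h1 := rss_signal_row_le u; have h2 := argmin_potts_rss (signal_row n fs) hu.
have h3 : n.+1%:R * g * (njumps (signal_row n fs))%:R <= n.+1%:R * g * K%:R.
  apply: ler_wpM2l; first by rewrite mulr_ge0.
  by rewrite ler_nat (njumps_signal_row sg).
lra.
Qed.

(** Each jump in excess of [K] costs [n * g] and gains at most [4 * B * K.+1]. *)
Lemma argmin_njumps_le (g : \bar R) u : (0 <= g)%E -> argmin_potts g Y u ->
  ((4 * B * K.+1%:R)%:E < n.+1%:R%:E * g)%E -> (njumps u <= K)%N.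
Proof.
case: g => [g| |]// g0 hu; last by rewrite (argmin_potts_oo hu).
rewrite lee_fin in g0; rewrite -EFinM lte_fin => hg.
rewrite leqNgt; apply/negP => Ku.
have [j hj] : exists j, njumps u = (K + j.+1)%N by exists (njumps u - K.+1)%N; lia.
have := argmin_misfit_le g0 hu; have := misfit_ge0 fs u; rewrite hj.
have -> : (K + (K + j.+1)).+1 = (K.+1 + K.+1 + j)%N by lia.
rewrite !natrD -(natr1 j).
have j0 : 0 <= j%:R :> R by [].
have K1 : 1 <= K.+1%:R :> R by rewrite ler1n.
move: hg; move: (K.+1%:R) (K%:R) (j%:R) (n.+1%:R * g) K1 j0 => k k' x G K1 j0 hg m0 hm.
have h1 : 0 <= B * x * (2 * k - 1) by rewrite mulr_ge0 ?mulr_ge0//; lra.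
have h2 : (G - 4 * B * k) * (x + 1) > 0 by rewrite mulr_gt0// ?subr_gt0//; lra.
have h3 : 0 <= B * x * k by rewrite !mulr_ge0//; lra.
lra.
Qed.

Lemma argmin_njumps_ge (g : R) u : 0 <= g -> argmin_potts g%:E Y u ->
  (njumps u <= K)%N ->
  4 * B * K.+1%:R + n.+1%:R * g * K%:R < rho * n.+1%:R * D ^+ 2 / 4 ->
  (forall k, (k < K)%N -> (0 < jumps (ext u) (q k) (q k.+1))%N).
Proof.
move=> g0 hu uK hn k kK; rewrite lt0n; apply/negP => /eqP /(missed_window_misfit sg kK) hm.
have := argmin_misfit_le g0 hu.
have h1 : 0 <= n.+1%:R * g * (njumps u)%:R by rewrite !mulr_ge0.
have h2 : 2 * B * (K + njumps u).+1%:R <= 4 * B * K.+1%:R.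
  rewrite (_ : 4 * B * _ = 2 * B * (2 * K.+1%:R)); last by ring.
  apply: ler_wpM2l; first by rewrite mulr_ge0.
  by rewrite -natrM ler_nat; lia.
lra.
Qed.

(** A vector that is constant on a window has large residual sums on the part of
    the window before the jump or on the part after it. *)
Lemma interval_bound_hits (V : R) (u : 'rV[R]_n.+1) : 0 <= V ->
  (forall a b, (a < b <= n.+1)%N ->
    `|\sum_(a <= i < b) (ext Y i - ext u i.+1)| <= V * Num.sqrt (b - a)%:R) ->
  4 * (V + Num.sqrt B) ^+ 2 < D ^+ 2 * (rho * n.+1%:R) ->
  forall k, (k < K)%N -> (0 < jumps (ext u) (q k) (q k.+1))%N.
Proof.
move=> V0 hV hn k kK; rewrite lt0n; apply/negP => /eqP /jumps0 hu.
have /andP[qp pq] := order kK.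
have qN := anchor_le sg kK.
have half a b x : (q k <= a < b)%N -> (b <= q k.+1)%N ->
    (forall i, (a <= i < b)%N -> fs i = x) ->
    (b - a)%:R * (x - ext u (q k)) ^+ 2 <= (V + Num.sqrt B) ^+ 2.
  move=> /andP[qa ab] bq fx; set c := ext u (q k).
  have l0 : 0 < (b - a)%:R :> R by rewrite ltr0n subn_gt0.
  have sl0 : 0 < Num.sqrt ((b - a)%:R : R) by rewrite sqrtr_gt0.
  have hZ : `|\sum_(a <= i < b) z i| <= Num.sqrt B * Num.sqrt (b - a)%:R.
    rewrite -sqrtrM// -sqrtr_sqr ler_wsqrtr//; apply: z_le.
    by rewrite (ltnW ab) (leq_trans bq qN).
  have bn := leq_trans bq qN.
  have habV : (a < b <= n.+1)%N by rewrite ab.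
  have := hV a b habV.
  have -> : \sum_(a <= i < b) (ext Y i - ext u i.+1) =
      (b - a)%:R * (x - c) + \sum_(a <= i < b) z i.
    rewrite mulr_natl -sumr_const_nat -big_split/=; apply: eq_big_nat => i hi.
    have /andP[ai ib] := hi; rewrite Y_split; last exact: leq_trans ib bn.
    rewrite fx// hu; first by rewrite /c; ring.
    by rewrite (leq_trans qa (leqW ai)) (leq_trans ib bq).
  move=> h.
  have h2 : `|(b - a)%:R * (x - c)| <= (V + Num.sqrt B) * Num.sqrt (b - a)%:R.
    have := ler_normB ((b - a)%:R * (x - c) + \sum_(a <= i < b) z i) (\sum_(a <= i < b) z i).
    by rewrite addrK mulrDl; lra.
  rewrite -(ler_pM2r l0) -{3}(sqr_sqrtr (ltW l0)) -exprMn.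
  have -> : (b - a)%:R * (x - c) ^+ 2 * (b - a)%:R = `|(b - a)%:R * (x - c)| ^+ 2.
    by rewrite real_normK ?num_real//; ring.
  by rewrite lerXn2r ?nnegrE//; rewrite mulr_ge0 ?addr_ge0 ?sqrtr_ge0.
have rN : 0 < rho * n.+1%:R by rewrite mulr_gt0.
have qp' : (q k < p k)%N.
  by have := lt_le_trans rN (sep_left kK); rewrite ltr0n subn_gt0.
have pq' : (p k < q k.+1)%N.
  by have := lt_le_trans rN (sep_right kK); rewrite ltr0n subn_gt0.
have h1 := half _ _ _ (introT andP (conj (leqnn _) qp')) pq (fun i hi => fs_left kK hi).
have h2 := half _ _ _ (introT andP (conj qp pq')) (leqnn _) (fun i hi => fs_right kK hi).
have := sum_window_sep sg kK (gap_split sg (ext u (q k)) kK) erefl.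
lra.
Qed.

End potts_fit.

(** * Sampling a step function *)

Section reduced_steps.
Context (R : realType).

Definition steps (f : R -> R) (m : nat) (alpha t : nat -> R) : Prop :=
  [/\ t 0%N = 0, t m = 1, (forall i, (i < m)%N -> t i < t i.+1) &
      forall i x, (i < m)%N -> t i <= x < t i.+1 -> f x = alpha i].

Lemma steps_mono f m alpha t i j : steps f m alpha t -> (i <= j <= m)%N -> t i <= t j.
Proof.
move=> [_ _ incr _] /andP[ij]; elim: j ij => [|j IH]; first by rewrite leqn0 => /eqP ->.
rewrite leq_eqVlt => /orP[/eqP -> //|ij] jm.
by apply: le_trans (IH ij (ltnW jm)) _; apply/ltW/incr.
Qed.

Lemma right_cont_step_steps f : right_cont_step f -> exists m alpha t, steps f m alpha t.
Proof.
move=> [m [alpha [t [t0 tm incr fE]]]]; exists m, alpha, t; split => // i x im /andP[ix xi].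
have st : steps (fun=> 0) m (fun=> 0) t by split.
have t0i := @steps_mono _ _ _ _ 0 i st ltac:(lia).
have tim := @steps_mono _ _ _ _ i.+1 m st ltac:(lia).
rewrite fE; last by rewrite -[X in X <= _ < _]t0 (le_trans t0i ix)/= -tm (lt_le_trans xi tim).
rewrite (bigD1 (Ordinal im))//= indicE mem_set/= ?in_itv/= ?ix//.
rewrite mulr1 big1 ?addr0// => j ji; rewrite indicE memNset ?mulr0//=.
rewrite in_itv/= => /andP[jx xj].
have [h|h|h] := ltngtP (j : nat) i.
- have := @steps_mono _ _ _ _ j.+1 i st ltac:(lia); lra.
- have := @steps_mono _ _ _ _ i.+1 j st; have := ltn_ord j => ? /(_ ltac:(lia)); lra.
- by move/eqP: ji; apply; apply: val_inj.
Qed.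

Lemma steps_merge f m alpha t i : steps f m.+1 alpha t -> (i.+1 < m.+1)%N ->
  alpha i = alpha i.+1 ->
  steps f m (fun j => alpha (if (j <= i)%N then j else j.+1))
            (fun j => t (if (j <= i)%N then j else j.+1)).
Proof.
move=> [t0 tm incr fE] im ai; split => //.
- by rewrite ifF//; lia.
- move=> j jm; have [ji|ij] := leqP j.+1 i.
    by rewrite (ltnW ji); apply: incr; lia.
  have [ji|ji] := leqP j i; last by apply: incr; lia.
  by apply: lt_trans (incr j _) (incr j.+1 _); lia.
- move=> j x jm; have [ji|ij] := leqP j.+1 i.
    by rewrite (ltnW ji); apply: fE; lia.
  have [ji|ji] := leqP j i; last by apply: fE; lia.
  have -> : j = i by lia.
  move=> /andP[h1 h2]; have [h|h] := ltP x (t i.+1); first by apply: fE; rewrite ?h1//; lia.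
  by rewrite ai; apply: fE; rewrite ?h ?h2//; lia.
Qed.

(** Merging two adjacent pieces with the same value shortens the representation,
    so a shortest one has genuine jumps only. *)
Lemma right_cont_step_reduced f : right_cont_step f ->
  exists K alpha t, steps f K.+1 alpha t /\
    forall k, (k < K)%N -> alpha k != alpha k.+1.
Proof.
move=> /right_cont_step_steps[m [alpha [t st]]].
elim: m alpha t st => [|m IH] alpha t st.
  by case: st => t0 t1; rewrite t0 in t1; move/eqP: t1; rewrite eq_sym oner_eq0.
have [red|/existsNP[i /not_implyP[im /negP]]] :=
    pselect (forall k, (k < m)%N -> alpha k != alpha k.+1).
  by exists m, alpha, t.
by rewrite negbK => /eqP /(steps_merge st im); apply: IH.
Qed.

Lemma finite_pos_lower_bound (g : nat -> R) K : (forall k, (k < K)%N -> 0 < g k) ->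
  exists D : R, 0 < D /\ forall k, (k < K)%N -> D <= g k.
Proof.
elim: K => [|K IH] h; first by exists 1.
have [D [D0 hD]] := IH (fun k hk => h k (ltnW hk)).
exists (Num.min D (g K)); split; first by rewrite lt_min D0 h.
move=> k; rewrite ltnS leq_eqVlt => /orP[/eqP -> |hk].
  by rewrite ge_min lexx orbT.
by rewrite ge_min hD.
Qed.

Lemma finite_upper_bound (g : nat -> R) K :
  exists C : R, 0 <= C /\ forall k, (k < K)%N -> `|g k| <= C.
Proof.
exists (\sum_(k < K) `|g k|); split; first exact: sumr_ge0.
move=> k hk; rewrite (bigD1 (Ordinal hk))//= lerDl; exact: sumr_ge0.
Qed.

Definition nat_ceil (x : R) : nat := `|Num.ceil x|%N.

Lemma nat_ceil_le x i : 0 <= x -> (nat_ceil x <= i)%N = (x <= i%:R).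
Proof.
move=> x0; have c0 : 0 <= Num.ceil x by rewrite ceil_ge0 (lt_le_trans _ x0)// ltrN10.
rewrite -[i%:R]/((Posz i)%:~R) -ceil_le_int /nat_ceil.
by rewrite -{2}(gez0_abs c0) lez_nat.
Qed.

Lemma nat_ceil_ge x : 0 <= x -> x <= (nat_ceil x)%:R.
Proof. by move=> x0; rewrite -nat_ceil_le. Qed.

Lemma nat_ceil_lt x : 0 <= x -> (nat_ceil x)%:R < x + 1.
Proof.
move=> x0; rewrite ltNge; apply/negP => h.
have [c0|c0] := posnP (nat_ceil x); first by rewrite c0 in h; lra.
have : (nat_ceil x <= (nat_ceil x).-1)%N.
  rewrite nat_ceil_le//; move: h; rewrite -{1}(prednK c0) -natr1; lra.
lia.
Qed.

Lemma le_nat_ceil x y : 0 <= x -> x <= y -> (nat_ceil x <= nat_ceil y)%N.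
Proof.
move=> x0 xy; rewrite nat_ceil_le//; apply: (le_trans xy); apply: nat_ceil_ge.
exact: le_trans xy.
Qed.

End reduced_steps.

Section cell_means.
Context (R : realType) (n : nat).
Notation mu := (@lebesgue_measure R).

Lemma design_lt (i : nat) : design n.+1 i < design n.+1 i.+1 :> R.
Proof. by rewrite /design ltr_pM2r ?invr_gt0 ?ltr0n// ltr_nat. Qed.

Lemma bounded_integrable_cell (f : R -> R) (C : R) (i : nat) :
  measurable_fun (`[design n.+1 i, design n.+1 i.+1[ : set R) f ->
  (forall x, design n.+1 i <= x < design n.+1 i.+1 -> `|f x| <= C) ->
  mu.-integrable `[design n.+1 i, design n.+1 i.+1[ (EFin \o f).
Proof.
move=> mf fC; apply: measurable_bounded_integrable => //.
  by rewrite /= lebesgue_measure_itv/=; case: ifPn => // _; rewrite -EFinB ltry.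
exists C; split; first exact: num_real.
move=> M CM x /=; rewrite in_itv/= => hx.
by apply: le_trans (fC x hx) (ltW CM).
Qed.

(** The right end of the last cell is [1], where the value of [f] is arbitrary. *)
Lemma cell_mean_half_open (f : R -> R) (i : 'I_n.+1) :
  mu.-integrable `[design n.+1 i, design n.+1 i.+1[ (EFin \o f) ->
  cell_mean f i = (design n.+1 i.+1 - design n.+1 i)^-1 *
    \int[mu]_(u in `[design n.+1 i, design n.+1 i.+1[) f u.
Proof. by move=> hf; rewrite /cell_mean Rintegral_itv_bndo_bndc. Qed.

Lemma cell_mean_cst_integral (c : R) (i : nat) :
  (design n.+1 i.+1 - design n.+1 i)^-1 *
    (\int[mu]_(u in `[design n.+1 i, design n.+1 i.+1[) c)%R = c.
Proof.
have h := design_lt i.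
rewrite Rintegral_cst//= lebesgue_measure_itv/= lte_fin h -EFinB/=.
by rewrite mulrC mulfK// subr_eq0 gt_eqF.
Qed.

Lemma cell_mean_cst (f : R -> R) (c : R) (i : 'I_n.+1) :
  (forall x, design n.+1 i <= x < design n.+1 i.+1 -> f x = c) -> cell_mean f i = c.
Proof.
move=> fc; rewrite cell_mean_half_open.
  rewrite (@eq_Rintegral _ _ _ mu _ (cst c)); first exact: cell_mean_cst_integral.
  by move=> x; rewrite inE/= in_itv/= => /fc.
apply: (@bounded_integrable_cell _ `|c|).
  apply: (@eq_measurable_fun _ _ _ _ _ (cst c)) => // x.
  by rewrite inE/= in_itv/= => /fc.
by move=> x /fc ->.
Qed.

Lemma cell_mean_le (f : R -> R) (C : R) (i : 'I_n.+1) :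
  measurable_fun (`[0, 1[ : set R) f ->
  (forall x, 0 <= x < 1 -> `|f x| <= C) -> `|cell_mean f i| <= C.
Proof.
move=> mf fC.
have cell01 x : design n.+1 i <= x < design n.+1 i.+1 -> 0 <= x < 1.
  move=> /andP[h1 h2]; apply/andP; split.
    by apply: le_trans h1; rewrite /design divr_ge0.
  apply: lt_le_trans h2 _; rewrite /design ler_pdivrMr ?ltr0n// mul1r ler_nat.
  exact: ltn_ord.
have fint : mu.-integrable `[design n.+1 i, design n.+1 i.+1[ (EFin \o f).
  apply: (@bounded_integrable_cell _ C).
    apply: measurable_funS mf => // x /=; rewrite !in_itv/=; exact: cell01.
  by move=> x /cell01 /fC.
have cint : mu.-integrable `[design n.+1 i, design n.+1 i.+1[ (EFin \o (cst C : R -> R)).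
  by apply: (@bounded_integrable_cell _ `|C|).
rewrite cell_mean_half_open// normrM.
have h := design_lt i.
have l0 : 0 <= (design n.+1 i.+1 - design n.+1 i : R)^-1.
  by rewrite invr_ge0 subr_ge0 ltW.
rewrite (ger0_norm l0) -[leRHS](@cell_mean_cst_integral C i); apply: ler_wpM2l => //.
apply: le_trans (le_normr_Rintegral _ fint) _ => //.
apply: le_Rintegral => //.
  by have := integrable_norm fint.
by move=> x /=; rewrite in_itv/= => /cell01 /fC.
Qed.

End cell_means.

Lemma right_cont_step_measurable (R : realType) (f : R -> R) :
  right_cont_step f -> measurable_fun (`[0, 1[ : set R) f.
Proof.
move=> [m [alpha [t [_ _ _ fE]]]].
apply: (@eq_measurable_fun _ _ _ _ _
    (fun x => \sum_(i < m) alpha i * \1_(`[t i, t i.+1[) x)).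
  by move=> x; rewrite inE/= in_itv/= => /fE.
by apply: measurable_sum => i; apply: measurable_funM.
Qed.

Section grid.
Context (R : realType) (f : R -> R) (K : nat) (alpha t : nat -> R).
Hypothesis st : steps f K.+1 alpha t.

(** Cell [i] is [[i / N, i.+1 / N)] with [N = n.+1]. It lies to the right of a
    point [x] if and only if [x * N <= i]. *)
Definition jump_cell n k : nat := nat_ceil (t k.+1 * n.+1%:R).
Definition mid_cell n k : nat := nat_ceil ((t k + t k.+1) / 2 * n.+1%:R).
(** Repeating the last value past the end keeps the arbitrary value of [f] at [1]
    from creating a jump. *)
Definition grid_signal n i : R := f (design n.+1 (minn i n)).

Let t0 : t 0%N = 0. Proof. by case: st. Qed.
Let t1 : t K.+1 = 1. Proof. by case: st. Qed.
Let t_lt k : (k <= K)%N -> t k < t k.+1. Proof. by case: st => _ _ + _; apply. Qed.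
Let t_ge0 k : (k <= K.+1)%N -> 0 <= t k.
Proof. by move=> kK; rewrite -t0; apply: (steps_mono st); lia. Qed.
Let t_le1 k : (k <= K.+1)%N -> t k <= 1.
Proof. by move=> kK; rewrite -t1; apply: (steps_mono st); lia. Qed.
Let N0 n : 0 < n.+1%:R :> R. Proof. by rewrite ltr0n. Qed.

Lemma jump_cell_le n k i : (k <= K)%N -> (jump_cell n k <= i)%N = (t k.+1 * n.+1%:R <= i%:R).
Proof. by move=> kK; rewrite nat_ceil_le// mulr_ge0// t_ge0. Qed.

Lemma mid_cell_le n k i : (k <= K)%N ->
  (mid_cell n k <= i)%N = ((t k + t k.+1) / 2 * n.+1%:R <= i%:R).
Proof.
move=> kK; rewrite nat_ceil_le// mulr_ge0// divr_ge0// addr_ge0// t_ge0//; lia.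
Qed.

Lemma grid_signalE n i k : (i < n.+1)%N -> (k <= K)%N ->
  t k * n.+1%:R <= i%:R < t k.+1 * n.+1%:R -> grid_signal n i = alpha k.
Proof.
move=> hi kK hk; case: st => _ _ _ fE; rewrite /grid_signal (minn_idPl _) 1?ltnS//.
by apply: fE => //; rewrite /design ler_pdivlMr// ltr_pdivrMr.
Qed.

Lemma piece_of n i : (i < n.+1)%N ->
  exists k, (k <= K)%N /\ t k * n.+1%:R <= i%:R < t k.+1 * n.+1%:R.
Proof.
move=> hi.
have hK : i%:R < t K.+1 * n.+1%:R by rewrite t1 mul1r ltr_nat.
have ex : exists k, i%:R < t k.+1 * n.+1%:R by exists K.
case: (ex_minnP ex) => k hk kmin; have kK := kmin K hK.
exists k; split => //; rewrite hk andbT.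
case: k hk kmin kK => [|k] hk kmin kK; first by rewrite t0 mul0r.
by rewrite leNgt; apply/negP => /kmin; rewrite ltnn.
Qed.

(** Only the cell just before [jump_cell n k] can contain the jump [t k.+1] in its
    interior. *)
Lemma pure_cell n i : (i < n.+1)%N -> (forall k, (k < K)%N -> i.+1 != jump_cell n k) ->
  exists k, [/\ (k <= K)%N, t k * n.+1%:R <= i%:R < t k.+1 * n.+1%:R &
                i.+1%:R <= t k.+1 * n.+1%:R].
Proof.
move=> hi hj; have [k [kK /andP[h1 h2]]] := piece_of hi.
exists k; split => //; first by rewrite h1.
rewrite leNgt; apply/negP => h3.
have [kK'|Kk] := ltnP k K; last first.
  have kE : k = K by lia.
  by move: h3; rewrite kE t1 mul1r ltr_nat; lia.
have := hj k kK'; move/eqP; apply; apply/eqP; rewrite eqn_leq jump_cell_le// (ltW h3) andbT.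
by rewrite ltnNge jump_cell_le// -ltNge.
Qed.

Lemma grid_signal_jumps n : (jumps (grid_signal n) 0 n.+1 <= K)%N.
Proof.
apply: (@leq_trans (\sum_(0 <= i < n.+1) \sum_(k < K) (i.+1 == jump_cell n k))%N).
  rewrite /jumps !big_mkord; apply: leq_sum => i _.
  have [k|hj] := pselect (exists k : 'I_K, i.+1 == jump_cell n k).
    case: k => k hk; rewrite (bigD1 k)//= hk.
    by apply: leq_trans (leq_b1 _) _; rewrite leq_addr.
  have [//||k [kK h h']] := @pure_cell n i.
    by move=> k hk; apply/negP => E; apply: hj; exists (Ordinal hk).
  have [ni|ni] := eqVneq (i : nat) n.
    by rewrite ni /grid_signal minnn (minn_idPr (leqnSn n)) eqxx.
  have hi : (i.+1 < n.+1)%N by have := ltn_ord i; lia.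
  suff -> : grid_signal n i.+1 = grid_signal n i by rewrite eqxx.
  rewrite (@grid_signalE _ i k)//; apply: grid_signalE => //.
  rewrite lt_neqAle h' andbT; apply/andP; split.
    by case/andP: h => h _; apply: le_trans h _; rewrite ler_nat.
  apply/eqP => E; have [kK'|Kk] := ltnP k K.
    apply: hj; exists (Ordinal kK') => /=; rewrite eqn_leq jump_cell_le// -E lexx andbT.
    by rewrite ltnNge jump_cell_le// -ltNge; case/andP: h.
  have kE : k = K by lia.
  move: E; rewrite kE t1 mul1r => /eqP; rewrite eqr_nat; lia.
rewrite big_mkord exchange_big/=; apply: (@leq_trans (\sum_(k < K) 1)%N).
  apply: leq_sum => k _.
  have [c0|cn] := pselect (exists i : 'I_n.+1, i.+1 == jump_cell n k).
    case: c0 => i /eqP hi; rewrite (bigD1 i)//= hi eqxx big1// => j ji.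
    by apply/eqP; rewrite eqb0 -hi eqSS; apply: contra ji => /eqP /val_inj ->.
  by rewrite big1// => i _; apply/eqP; rewrite eqb0; apply/negP => h; apply: cn; exists i.
by rewrite sum1_card card_ord.
Qed.

Lemma grid_step_signal : (forall k, (k < K)%N -> alpha k != alpha k.+1) ->
  exists D rho : R, [/\ 0 < D, 0 < rho & forall n, 1 <= rho * n.+1%:R ->
    step_signal n K (grid_signal n) (mid_cell n) (jump_cell n) alpha D rho].
Proof.
move=> red.
have [D [D0 hD]] := @finite_pos_lower_bound _ (fun k => `|alpha k - alpha k.+1|) K
  (fun k hk => ltac:(by rewrite normr_gt0 subr_eq0 red)).
have [rho [rho0 hr]] := @finite_pos_lower_bound _ (fun k => (t k.+1 - t k) / 4) K.+1
  (fun k hk => ltac:(by rewrite divr_gt0// subr_gt0 t_lt)).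
exists D, rho; split => // n hn.
have sep k : (k <= K)%N -> 4 * (rho * n.+1%:R) <= (t k.+1 - t k) * n.+1%:R.
  move=> kK; have := hr k kK; rewrite mulrA ler_pM2r//; lra.
have mid_ge0 k : (k <= K)%N -> 0 <= (t k + t k.+1) / 2 * n.+1%:R.
  by move=> kK; rewrite mulr_ge0// divr_ge0// addr_ge0// t_ge0//; lia.
have end_ge0 k : (k <= K)%N -> 0 <= t k.+1 * n.+1%:R by move=> kK; rewrite mulr_ge0// t_ge0.
have midP k : (k <= K)%N -> t k * n.+1%:R <= (t k + t k.+1) / 2 * n.+1%:R <= t k.+1 * n.+1%:R.
  by move=> kK; rewrite !ler_pM2r//; have := t_lt kK => h; apply/andP; split; lra.
have order k : (k < K)%N -> (mid_cell n k <= jump_cell n k <= mid_cell n k.+1)%N.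
  move=> kK; have /andP[_ h1] := midP k (ltnW kK); have /andP[h2 _] := midP k.+1 kK.
  by apply/andP; split; apply: le_nat_ceil => //; 
    [exact: mid_ge0 (ltnW kK)|exact: end_ge0 (ltnW kK)].
have value k i x y : (k <= K)%N -> (i < n.+1)%N -> t k * n.+1%:R <= x -> x <= i%:R ->
    i%:R < y -> y <= t k.+1 * n.+1%:R -> grid_signal n i = alpha k.
  move=> kK hi h1 h2 h3 h4; apply: grid_signalE => //.
  by rewrite (le_trans h1 h2) (lt_le_trans h3 h4).
have mid_le k : (k <= K)%N -> (mid_cell n k <= n.+1)%N.
  move=> kK; rewrite mid_cell_le//; have /andP[_ h] := midP k kK.
  by apply: le_trans h _; rewrite -[leRHS]mul1r ler_pM2r// t_le1.
split => //.
- exact: mid_le.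
- move=> i hi; have hi' : (i < n.+1)%N by apply: leq_trans hi (mid_le 0%N _).
  have /andP[_ h] := midP 0%N (leq0n K).
  apply: (@value _ _ 0 ((t 0%N + t 1%N) / 2 * n.+1%:R)) => //; first by rewrite t0 mul0r.
  by rewrite ltNge -mid_cell_le// -ltnNge.
- move=> k i kK /andP[h1 h2].
  have hi' : (i < n.+1)%N by have := order k kK; have := mid_le k.+1 kK; lia.
  have /andP[h _] := midP k (ltnW kK).
  apply: (@value _ _ _ (t k.+1 * n.+1%:R) (ltnW kK) hi' h) => //.
    by rewrite -mid_cell_le// ltnW.
  by rewrite ltNge -jump_cell_le ?(ltnW kK)// -ltnNge.
- move=> k i kK /andP[h1 h2].
  have hi' : (i < n.+1)%N by have := mid_le k.+1 kK; lia.
  have /andP[_ h] := midP k.+1 kK.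
  apply: (@value _ _ (t k.+1 * n.+1%:R) _ kK hi' (lexx _) _ _ h).
    by rewrite -jump_cell_le// ltnW.
  by rewrite ltNge -mid_cell_le// -ltnNge.
- move=> i /andP[h1 h2]; have /andP[h _] := midP K (leqnn K).
  apply: (@value _ _ _ (t K.+1 * n.+1%:R) (leqnn K) h2 h) => //.
    by rewrite -mid_cell_le.
  by rewrite t1 mul1r ltr_nat.
- exact: grid_signal_jumps.
- move=> k kK; have kK' := ltnW kK; rewrite natrB; last by case/andP: (order k kK).
  have := nat_ceil_ge (end_ge0 k kK'); have := nat_ceil_lt (mid_ge0 k kK').
  rewrite -/(mid_cell n k) -/(jump_cell n k); have := sep k kK'; lra.
- move=> k kK; have kK' := ltnW kK; rewrite natrB; last by case/andP: (order k kK).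
  have := nat_ceil_lt (end_ge0 k kK'); have := nat_ceil_ge (mid_ge0 k.+1 kK).
  rewrite -/(mid_cell n k.+1) -/(jump_cell n k); have := sep k.+1 kK; lra.
Qed.

Lemma grid_signal_le C n i : (forall k, (k <= K)%N -> `|alpha k| <= C) -> (i < n.+1)%N ->
  `|grid_signal n i| <= C.
Proof.
move=> hC hi; have [k [kK h]] := piece_of hi.
by rewrite (@grid_signalE _ _ k)// hC.
Qed.

Lemma steps_le C x : (forall k, (k <= K)%N -> `|alpha k| <= C) -> 0 <= x < 1 -> `|f x| <= C.
Proof.
move=> hC /andP[x0 x1]; have ex : exists k, x < t k.+1 by exists K; rewrite t1.
case: (ex_minnP ex) => k hk kmin; have kK : (k <= K)%N by apply: kmin; rewrite t1.
case: st => _ _ _ fE; rewrite (fE k)//; first exact: hC.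
rewrite hk andbT; case: k hk kmin kK => [|k] hk kmin kK; first by rewrite t0.
by rewrite leNgt; apply/negP => /kmin; rewrite ltnn.
Qed.

(** The mean over a cell differs from the value at its left end only if the cell
    contains a jump in its interior. *)
Lemma cell_bias n (i : 'I_n.+1) C : right_cont_step f ->
  (forall k, (k <= K)%N -> `|alpha k| <= C) ->
  `|cell_mean f i - grid_signal n i| <= \sum_(k < K) 2 * C * (i.+1 == jump_cell n k)%:R.
Proof.
move=> fs hC; have C0 : 0 <= C by apply: le_trans (hC 0%N (leq0n K)).
have [[k hk]|hj] := pselect (exists k : 'I_K, i.+1 == jump_cell n k).
  rewrite (bigD1 k)//= hk mulr1; apply: (@le_trans _ _ (2 * C)); last first.
    by rewrite lerDl; apply: sumr_ge0 => j _; rewrite !mulr_ge0.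
  apply: le_trans (ler_normB _ _) _; rewrite mulr_natl mulr2n; apply: lerD.
    apply: cell_mean_le; first exact: right_cont_step_measurable.
    by move=> x; exact: steps_le.
  exact: grid_signal_le.
have [//||k [kK h h']] := @pure_cell n i.
  by move=> k hk; apply/negP => E; apply: hj; exists (Ordinal hk).
rewrite (grid_signalE _ kK h)// (@cell_mean_cst _ _ _ (alpha k)).
  by rewrite subrr normr0; apply: sumr_ge0 => j _; rewrite !mulr_ge0.
move=> x /andP[h1 h2]; case: st => _ _ _ fE; apply: fE => //; apply/andP; split.
  by apply: le_trans h1; rewrite ler_pdivlMr//; case/andP: h.
by apply: lt_le_trans h2 _; rewrite ler_pdivrMr.
Qed.

Lemma cell_bias_sum n C (h : nat -> R) a b : right_cont_step f ->
  (forall k, (k <= K)%N -> `|alpha k| <= C) -> (b <= n.+1)%N ->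
  (forall i : 'I_n.+1, h i = cell_mean f i - grid_signal n i) ->
  `|\sum_(a <= i < b) h i| <= 2 * C * K%:R.
Proof.
move=> fs hC bn hE; have C0 : 0 <= C by apply: le_trans (hC 0%N (leq0n K)).
apply: le_trans (ler_norm_sum _ _ _) _.
apply: (@le_trans _ _ (\sum_(a <= i < b) \sum_(k < K) 2 * C * (i.+1 == jump_cell n k)%:R)).
  apply: ler_sum_nat => i hi; have hi' : (i < n.+1)%N by lia.
  by rewrite -[i]/(val (Ordinal hi')) hE; exact: cell_bias.
rewrite exchange_big/= mulr_natr -[in leRHS](card_ord K) -sumr_const.
apply: ler_sum => k _; rewrite -mulr_sumr -[leRHS]mulr1 ler_wpM2l ?mulr_ge0//.
rewrite -natr_sum -[leRHS]/(1%:R) ler_nat.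
have [c0|cn] := boolP ((jump_cell n k).-1 \in index_iota a b); last first.
  rewrite big_nat_cond big1// => i /andP[hi _]; apply/eqP; rewrite eqb0.
  by apply: contra cn => /eqP <-; rewrite mem_index_iota.
rewrite (bigD1_seq _ c0 (iota_uniq _ _))/= big1.
  by rewrite addn0 leq_b1.
by move=> i hi; apply/eqP; rewrite eqb0; apply: contra hi => /eqP <-.
Qed.

End grid.

(** * The multiresolution bound in terms of vectors *)

Section embedding.
Context (R : realType) (n : nat).
Implicit Types (u v : 'rV[R]_n.+1).

Lemma iota_step_cell u (i : 'I_n.+1) x :
  design n.+1 i <= x < design n.+1 i.+1 -> iota_step u x = u 0 i.
Proof.
move=> /andP[ix xi]; rewrite /iota_step (bigD1 i)//= indicE mem_set/= ?in_itv/= ?ix//.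
rewrite mulr1 big1 ?addr0// => j ji; rewrite indicE memNset ?mulr0//=.
rewrite in_itv/= => /andP[jx xj].
have N0 : 0 < n.+1%:R :> R by rewrite ltr0n.
move: ix xi jx xj; rewrite /design !ler_pdivrMr// !ltr_pdivlMr// => ix xi jx xj.
have := le_lt_trans ix xj; have := le_lt_trans jx xi; rewrite !ltr_nat => h1 h2.
by move/eqP: ji; apply; apply: val_inj => /=; lia.
Qed.

Lemma iota_embed_design u i : (i < n.+1)%N -> iota_embed u (design n.+1 i) = ext u i.
Proof.
move=> hi; rewrite /iota_embed ifF.
  by rewrite (@iota_step_cell _ (Ordinal hi)) ?lexx ?design_lt// -[i]/(val (Ordinal hi)) extE.
by apply/eqP; rewrite /design => /divr1_eq /eqP; rewrite eqr_nat; lia.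
Qed.

Lemma iota_embed1 u : iota_embed u 1 = ext u n.
Proof.
rewrite /iota_embed eqxx; apply/cvg_lim => //; apply: cvg_near_cst.
have d1 : design n.+1 n < 1 :> R.
  by rewrite /design ltr_pdivrMr ?ltr0n// mul1r ltr_nat.
near=> y; rewrite -[n in ext u n]/(val (@ord_max n)) extE.
apply: iota_step_cell; apply/andP; split.
  by apply: ltW; near: y; apply: nbhs_left_gt.
by rewrite /design divff ?pnatr_eq0//=; near: y; exact: nbhs_left_lt.
Unshelve. all: by end_near. Qed.

(** The value of the embedded vector at the right end of cell [i] is the next
    entry, except for the last cell. *)
Lemma iota_embed_next u i : (i < n.+1)%N -> iota_embed u (design n.+1 i.+1) = ext u i.+1.
Proof.
move=> hi; have [h|h] := ltnP i.+1 n.+1; first exact: iota_embed_design.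
have -> : i.+1 = n.+1 by lia.
by rewrite /design divff ?pnatr_eq0// iota_embed1 (ext_last _ (leqnSn n)).
Qed.

Lemma iota_embed_inj : injective (@iota_embed R n.+1).
Proof.
move=> u v uv; apply/rowP => i; have := congr1 (fun h => h (design n.+1 i)) uv.
by rewrite !iota_embed_design// !extE.
Qed.

Definition interval_set a b : {set 'I_n.+1} := [set i : 'I_n.+1 | (a <= i < b)%N].

Lemma sum_interval_set (V : zmodType) (F : nat -> V) a b : (b <= n.+1)%N ->
  \sum_(i in interval_set a b) F i = \sum_(a <= i < b) F i.
Proof.
move=> bn; rewrite (big_nat_widen _ _ n.+1)// (big_nat_widenl _ 0)// big_mkord.
by apply: eq_bigl => i; rewrite inE andbC.
Qed.

Lemma card_interval_set a b : (b <= n.+1)%N -> #|interval_set a b| = (b - a)%N.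
Proof.
move=> bn; apply/eqP; rewrite -(eqr_nat R) -sumr_const.
by rewrite (@sum_interval_set R (fun=> 1))// sumr_const_nat.
Qed.

Lemma connected_interval_set a b : (a < b <= n.+1)%N -> connected_idx (interval_set a b).
Proof.
move=> /andP[ab bn]; split.
  apply/finset.set0Pn; exists (Ordinal (leq_trans ab bn)); rewrite inE /= leqnn ab//.
by move=> i j k; rewrite !inE; lia.
Qed.

Lemma connected_idxP (I : {set 'I_n.+1}) : connected_idx I ->
  exists a b, (a < b <= n.+1)%N /\ I = interval_set a b.
Proof.
move=> [/finset.set0Pn[i0 hi0] conn].
case: (@arg_minnP _ i0 (mem I) val hi0) => i iI imin.
case: (@arg_maxnP _ i0 (mem I) val hi0) => j jI jmax.
exists i, j.+1; split.
  by rewrite ltnS; apply/andP; split; [exact: imin|exact: ltn_ord].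
apply/finset.setP => k; rewrite !inE; apply/idP/idP => [kI|hk].
  by rewrite ltnS; apply/andP; split; [exact: imin|exact: jmax].
by apply: (conn i k j).
Qed.

Lemma MR_boundP (delta s : R) (Y u : 'rV[R]_n.+1) :
  MR_bound delta s Y u <-> forall a b, (a < b <= n.+1)%N ->
    `|\sum_(a <= i < b) (ext Y i - ext u i.+1)| <=
      (1 + delta) * s * Num.sqrt (2 * ln n.+1%:R) * Num.sqrt (b - a)%:R.
Proof.
have E a b : (a < b <= n.+1)%N ->
    (Num.sqrt #|interval_set a b|%:R)^-1 *
      `| \sum_(i in interval_set a b) (Y 0 i - iota_embed u (design n.+1 i.+1)) | =
    `|\sum_(a <= i < b) (ext Y i - ext u i.+1)| / Num.sqrt (b - a)%:R.
  move=> /andP[ab bn]; rewrite card_interval_set// mulrC; congr (`| _ | / _).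
  rewrite -(sum_interval_set _ _ bn); apply: eq_bigr => i _.
  by rewrite extE iota_embed_next.
have pos a b : (a < b)%N -> 0 < Num.sqrt ((b - a)%:R : R).
  by move=> ab; rewrite sqrtr_gt0 ltr0n subn_gt0.
split=> [h a b hab|h I /connected_idxP[a [b [hab ->]]]].
  have := h _ (connected_interval_set hab).
  by rewrite E// ler_pdivrMr// pos//; case/andP: hab.
by rewrite E// ler_pdivrMr; [exact: h|rewrite pos//; case/andP: hab].
Qed.

End embedding.

(** * Equality of the two fits *)

Section mr_fit.
Context (R : realType) (n K : nat) (Y : 'rV[R]_n.+1) (fs z : nat -> R).
Context (q p : nat -> nat) (lev : nat -> R) (D rho : R).
Context (sigma delta s t tau C C0 : R) (ns : nat -> nat -> R).
(* [ns a b] is the sum of the noise over [[a, b)], [C0] bounds the sums of the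
   bias, and [s] is the estimate of [sigma]. *)
Hypothesis sg : step_signal n K fs q p lev D rho.
Hypothesis Y_split : forall i, (i < n.+1)%N -> ext Y i = fs i + z i.
Hypothesis fs_le : forall i, (i < n.+1)%N -> `|fs i| <= C.
Hypothesis C0_ge0 : 0 <= C0.
Hypothesis sigma_gt0 : 0 < sigma.
Hypothesis delta_gt0 : 0 < delta.
Hypothesis t_gt0 : 0 < t.
Hypothesis tau_gt0 : 0 < tau.
Let L := ln (n.+1%:R : R).
Hypothesis z_noise : forall a b, (a <= b <= n.+1)%N ->
  `|\sum_(a <= i < b) z i| <= `|ns a b| + C0.
Hypothesis ns_all : forall a b, (a <= b <= n.+1)%N ->
  `|ns a b| <= sigma * t * Num.sqrt (L * (b - a)%:R).
Hypothesis ns_anchor : forall k, (k <= K)%N ->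
  forall b, (b <= n.+1)%N -> (q k <= n.+1)%N ->
  `|ns (q k) b| <= sigma * tau * Num.sqrt (L * (b - q k)%:R) /\
  `|ns b (q k)| <= sigma * tau * Num.sqrt (L * (q k - b)%:R).
Hypothesis ns_jump : forall k, (k < K)%N ->
  forall b, (b <= n.+1)%N -> (p k <= n.+1)%N ->
  `|ns (p k) b| <= sigma * tau * Num.sqrt (L * (b - p k)%:R) /\
  `|ns b (p k)| <= sigma * tau * Num.sqrt (L * (p k - b)%:R).
Hypothesis L_ge1 : 1 <= L.
Hypothesis L_anchor : C0 <= sigma * tau * Num.sqrt L.
Hypothesis L_const : C0 + 2 * C <= sigma * delta / 8 * Num.sqrt L.

Definition crude_bound : R := (sigma * t + C0) ^+ 2.
Let crude_ge0 : 0 <= crude_bound. Proof. exact: sqr_ge0. Qed.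
Let L_ge0 : 0 <= L. Proof. exact: le_trans L_ge1. Qed.
Let B := crude_bound * L.
Let A := (2 * (sigma * tau)) ^+ 2 * L.

Let sum_le_of (c : R) a b : (a <= b <= n.+1)%N -> 0 <= c ->
  `|ns a b| + C0 <= c * Num.sqrt L * Num.sqrt (b - a)%:R \/ a = b ->
  sum_le (c ^+ 2 * L) z a b.
Proof.
move=> hab c0 [h|->]; last by rewrite /sum_le big_geq// subnn mulr0 expr0n.
rewrite /sum_le -[leLHS]real_normK ?num_real//.
have -> : c ^+ 2 * L * (b - a)%:R = (c * Num.sqrt L * Num.sqrt (b - a)%:R) ^+ 2.
  by rewrite !exprMn !sqr_sqrtr.
rewrite lerXn2r ?nnegrE ?mulr_ge0 ?sqrtr_ge0//.
exact: le_trans (z_noise hab) h.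
Qed.

Let len1 a b : (a < b)%N -> 1 <= Num.sqrt ((b - a)%:R : R).
Proof. by move=> ab; rewrite -[leLHS]sqrtr1 ler_wsqrtr// ler1n subn_gt0. Qed.

Lemma crude_sum_le a b : (a <= b <= n.+1)%N -> sum_le B z a b.
Proof.
move=> hab; apply: sum_le_of => //; first by rewrite addr_ge0// mulr_ge0// ltW.
have [ab|ba] := ltnP a b; last first.
  by right; apply/eqP; rewrite eqn_leq ba andbT; case/andP: hab.
left; rewrite 2!mulrDl; apply: lerD.
  by rewrite -mulrA -sqrtrM//; exact: ns_all.
rewrite -mulrA ler_peMr// mulr_ege1//; last exact: len1.
by rewrite -[leLHS]sqrtr1 ler_wsqrtr.
Qed.

Let anchored_sum_le a b : (a <= b <= n.+1)%N ->
  `|ns a b| <= sigma * tau * Num.sqrt (L * (b - a)%:R) -> sum_le A z a b.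
Proof.
move=> hab h; apply: sum_le_of => //; first by rewrite !mulr_ge0// ltW.
have [ab|ba] := ltnP a b; last first.
  by right; apply/eqP; rewrite eqn_leq ba andbT; case/andP: hab.
left; rewrite (_ : 2 * (sigma * tau) = sigma * tau + sigma * tau); last by ring.
rewrite 2!mulrDl; apply: lerD.
  by rewrite -mulrA -sqrtrM.
apply: le_trans L_anchor _; rewrite ler_peMr ?len1//.
by rewrite !mulr_ge0// ltW.
Qed.

Hypothesis tau_small : 24 * (sigma * tau) * Num.sqrt K.+1%:R <= sigma * delta / 8.
Hypothesis t_small : sigma * t + sigma * delta / 4 <= (1 + delta) * s * Num.sqrt 2.
Hypothesis s_ge0 : 0 <= s.
Hypothesis s_le : s <= 2 * sigma.
Hypothesis L_window : 4 * ((1 + delta) * (2 * sigma) * Num.sqrt 2 + sigma * t + C0) ^+ 2 * L <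
  D ^+ 2 * (rho * n.+1%:R).
Hypothesis energies : energies_differ Y.

Variables (g : R) (gMR : \bar R) (u_hat u_MR : 'rV[R]_n.+1).
Hypothesis u_hat_argmin : argmin_potts g%:E Y u_hat.
Hypothesis g_rate : 4 * crude_bound * K.+1%:R * L < n.+1%:R * g.
Hypothesis g_small : 4 * crude_bound * K.+1%:R * L + n.+1%:R * g * K%:R <
  rho * n.+1%:R * D ^+ 2 / 4.
Hypothesis MR_ok :
  (exists g' u, MR_admissible delta s Y g' u) -> MR_choice delta s Y gMR u_MR.

Let B_ge0 : 0 <= B.
Proof. exact: mulr_ge0. Qed.

Let N0 : 0 < n.+1%:R :> R. Proof. by rewrite ltr0n. Qed.

Let g_gt0 : 0 < g.
Proof.
rewrite -(pmulr_rgt0 _ N0); apply: le_lt_trans g_rate.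
by do 3 apply: mulr_ge0 => //.
Qed.

Let few_jumps (g' : \bar R) u : (g%:E <= g')%E -> argmin_potts g' Y u -> (njumps u <= K)%N.
Proof.
move=> gg' hu.
have g'0 : (0 <= g')%E by apply: le_trans gg'; rewrite lee_fin ltW.
apply: (argmin_njumps_le sg Y_split B_ge0 crude_sum_le g'0 hu).
apply: (@lt_le_trans _ _ (n.+1%:R * g)%:E).
  by rewrite lte_fin /B; move: g_rate; lra.
by rewrite EFinM lee_pmul2l// lte_fin.
Qed.

Let hat_hits k : (k < K)%N -> (0 < jumps (ext u_hat) (q k) (q k.+1))%N.
Proof.
apply: (argmin_njumps_ge sg Y_split B_ge0 crude_sum_le (ltW g_gt0) u_hat_argmin).
  exact: (few_jumps (lexx _) u_hat_argmin).
by rewrite /B; move: g_small; lra.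
Qed.

Let hat_njumps : njumps u_hat = K.
Proof.
apply/eqP; rewrite eqn_leq (few_jumps (lexx _) u_hat_argmin)/=.
by apply: (windows_hit_njumps sg) => k kK; exact: hat_hits.
Qed.

(** The squared distance of the fit to the signal is at most [16 * A * K.+1], that
    is [64 * K.+1 * (sigma * tau) ^ 2 * L]; three times its square root is what
    [tau_small] compares to [sigma * delta / 8]. *)
Lemma hat_MR_bound : MR_bound delta s Y u_hat.
Proof.
have A0 : 0 <= A by rewrite mulr_ge0 ?sqr_ge0.
have hm : misfit fs u_hat <= 16 * A * K.+1%:R.
  apply: (localized_misfit sg Y_split A0 (ltW g_gt0) u_hat_argmin hat_njumps hat_hits).
    move=> k b kK bn.
    have qn := anchor_le sg kK.
    have [h1 h2] := ns_anchor kK bn qn; split.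
      have [qb|bq] := leqP (q k) b; first by apply: anchored_sum_le => //; exact/andP.
      by rewrite /sum_le big_geq ?(ltnW bq)// expr0n mulr_ge0.
    have [bq|qb] := leqP b (q k); first by apply: anchored_sum_le => //; exact/andP.
    by rewrite /sum_le big_geq ?(ltnW qb)// expr0n mulr_ge0.
  move=> k b kK bn.
  have pn := jump_le sg kK.
  have [h1 h2] := ns_jump kK bn pn; split.
    have [qb|bq] := leqP (p k) b; first by apply: anchored_sum_le => //; exact/andP.
    by rewrite /sum_le big_geq ?(ltnW bq)// expr0n mulr_ge0.
  have [bq|qb] := leqP b (p k); first by apply: anchored_sum_le => //; exact/andP.
  by rewrite /sum_le big_geq ?(ltnW qb)// expr0n mulr_ge0.
apply/MR_boundP => a b hab; have /andP[ab bn] := hab.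
have hz : `|\sum_(a <= i < b) z i| <= sigma * t * Num.sqrt (L * (b - a)%:R) + C0.
  have hab' : (a <= b <= n.+1)%N by rewrite (ltnW ab).
  by apply: le_trans (z_noise hab') _; rewrite lerD2r ns_all.
apply: le_trans (interval_residual_le Y_split u_hat hab fs_le hz) _.
have hs : Num.sqrt (misfit fs u_hat) <= 8 * (sigma * tau) * Num.sqrt K.+1%:R * Num.sqrt L.
  have c0 : 0 <= 8 * (sigma * tau) by rewrite !mulr_ge0// ltW.
  have c2 : 0 <= (8 * (sigma * tau)) ^+ 2 by exact: sqr_ge0.
  have c3 : 0 <= (8 * (sigma * tau)) ^+ 2 * K.+1%:R by exact: mulr_ge0.
  rewrite -[X in X * _ * _](ger0_norm c0) -sqrtr_sqr -sqrtrM// -sqrtrM//.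
  apply: ler_wsqrtr; apply: le_trans hm _.
  by rewrite le_eqVlt; apply/orP; left; apply/eqP; rewrite /A; ring.
have l1 := len1 ab; set l := Num.sqrt ((b - a)%:R : R) in l1 *.
rewrite -/L sqrtrM// sqrtrM// -/l.
have sL : 0 <= Num.sqrt L by exact: sqrtr_ge0.
have l0 : 0 <= l by lra.
have h1 : C0 + 2 * C <= sigma * delta / 8 * Num.sqrt L * l.
  by apply: le_trans L_const _; rewrite ler_peMr// !mulr_ge0// ltW.
have h2 : 3 * Num.sqrt (misfit fs u_hat) * l <= sigma * delta / 8 * Num.sqrt L * l.
  apply: ler_wpM2r => //.
  have := ler_wpM2r sL tau_small; lra.
have := ler_wpM2r (mulr_ge0 sL l0) t_small.
lra.
Qed.

(** The fit [u_hat] is admissible, hence [g <= gMR]. So [u_MR] has at most [K]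
    jumps, and at least [K] by its multiresolution bound. *)
Lemma MR_fit_unique : u_MR = u_hat.
Proof.
have g0 : (0 <= g%:E)%E by rewrite lee_fin ltW.
have adm : MR_admissible delta s Y g%:E u_hat by split => //; exact: hat_MR_bound.
have [[gMR0 hMR bMR] gmax] := MR_ok (ex_intro _ _ (ex_intro _ _ adm)).
have gg : (g%:E <= gMR)%E := gmax _ _ adm.
pose V := (1 + delta) * s * Num.sqrt (2 * L).
have V0 : 0 <= V by rewrite !mulr_ge0 ?sqrtr_ge0// addr_ge0// ltW.
have hits k : (k < K)%N -> (0 < jumps (ext u_MR) (q k) (q k.+1))%N.
  apply: (interval_bound_hits sg Y_split B_ge0 crude_sum_le V0).
    by move/MR_boundP: bMR.
  apply: le_lt_trans L_window; rewrite -mulrA ler_pM2l//.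
  have -> : V + Num.sqrt B = ((1 + delta) * s * Num.sqrt 2 + (sigma * t + C0)) * Num.sqrt L.
    have -> : Num.sqrt B = (sigma * t + C0) * Num.sqrt L.
      rewrite /B /crude_bound sqrtrM ?sqr_ge0// sqrtr_sqr ger0_norm//.
      by rewrite addr_ge0// mulr_ge0// ltW.
    by rewrite /V sqrtrM//; ring.
  rewrite exprMn sqr_sqrtr//; apply: ler_wpM2r => //.
  have c0 : 0 <= sigma * t + C0 by rewrite addr_ge0// mulr_ge0// ltW.
  have d0 : 0 <= (1 + delta) * s * Num.sqrt 2.
    by rewrite !mulr_ge0 ?sqrtr_ge0// addr_ge0// ltW.
  have h : (1 + delta) * s * Num.sqrt 2 <= (1 + delta) * (2 * sigma) * Num.sqrt 2.
    by apply: ler_wpM2r; rewrite ?sqrtr_ge0//; apply: ler_wpM2l => //; rewrite addr_ge0// ltW.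
  have e1 : 0 <= (1 + delta) * s * Num.sqrt 2 + (sigma * t + C0) by exact: addr_ge0.
  have e2 : (1 + delta) * s * Num.sqrt 2 + (sigma * t + C0) <=
      (1 + delta) * (2 * sigma) * Num.sqrt 2 + sigma * t + C0.
    by rewrite addrA !lerD2r.
  by rewrite lerXn2r ?nnegrE//; exact: le_trans e1 e2.
have jMR : njumps u_MR = K.
  by apply/eqP; rewrite eqn_leq (few_jumps gg hMR)/=;
    apply: (windows_hit_njumps sg); exact: hits.
apply: (least_squares_unique energies); first by rewrite jMR hat_njumps.
  by move=> v; exact: argmin_potts_least_squares hMR.
by move=> v; exact: argmin_potts_least_squares u_hat_argmin.
Qed.

End mr_fit.

(** * The two reconstructions agree with probability tending to one *)

Lemma ge_sqrt_ln (R : realType) (c d L : R) : 0 <= c -> 0 < d -> (c / d) ^+ 2 <= L ->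
  c <= d * Num.sqrt L.
Proof.
move=> c0 d0 h; rewrite mulrC -ler_pdivrMr//.
rewrite -[leLHS]ger0_norm ?divr_ge0 ?(ltW d0)// -sqrtr_sqr.
exact: ler_wsqrtr.
Qed.

Lemma measurable_equal_fits (d : measure_display) (T : measurableType d) (R : realType)
    (P : probability T R) (n : nat) (u v : 'I_n.+1 -> {RV P >-> R}) :
  measurable [set w | iota_embed (random_vector u w) = iota_embed (random_vector v w)].
Proof.
rewrite (_ : [set w | _] = \bigcap_(i in [set: 'I_n.+1]) [set w | u i w - v i w = 0]).
  apply: fin_bigcap_measurable => // i _.
  have h : measurable_fun [set: T] (fun w => u i w - v i w) by exact: measurable_funB.
  by have := h measurableT [set 0] (measurable_set1 0); rewrite setTI.
apply/seteqP; split => w /=.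
  move=> /iota_embed_inj uv i _; have := congr1 (fun r : 'rV_n.+1 => r 0 i) uv.
  by rewrite !mxE => E; apply/eqP; rewrite subr_eq0; apply/eqP; exact: E.
move=> h; congr iota_embed; apply/rowP => i; rewrite !mxE; apply/eqP.
by rewrite -subr_eq0; apply/eqP/h.
Qed.

Section observations.
Context d (T : measurableType d) (R : realType) (P : probability T R).
Context (f : R -> R) (n K : nat) (alpha t : nat -> R) (C : R).
Context (xi : 'I_n.+1 -> {RV P >-> R}).
Hypothesis f_step : right_cont_step f.
Hypothesis st : steps f K.+1 alpha t.
Hypothesis alpha_le : forall k, (k <= K)%N -> `|alpha k| <= C.

Lemma observations_noise (w : T) (a b : nat) : (a <= b <= n.+1)%N ->
  `|\sum_(a <= i < b) (ext (observations f xi w) i - grid_signal f n i)| <=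
  `|\sum_(i < n.+1 | (a <= i < b)%N) xi i w| + 2 * C * K%:R.
Proof.
move=> /andP[ab bn]; pose m : 'rV[R]_n.+1 := \row_i cell_mean f i.
have -> : \sum_(i < n.+1 | (a <= i < b)%N) xi i w =
    \sum_(a <= i < b) ext (\row_i xi i w) i.
  rewrite -(sum_interval_set _ _ bn); apply: eq_big => [i|i _]; first by rewrite inE.
  by rewrite extE mxE.
have -> : \sum_(a <= i < b) (ext (observations f xi w) i - grid_signal f n i) =
    \sum_(a <= i < b) ext (\row_i xi i w) i +
    \sum_(a <= i < b) (ext m i - grid_signal f n i).
  rewrite -big_split/=; apply: eq_big_nat => i /andP[_ ib].
  have hi : (i < n.+1)%N := leq_trans ib bn.
  by rewrite -[i]/(val (Ordinal hi)) !extE !mxE; ring.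
apply: le_trans (ler_normD _ _) _; rewrite lerD2l.
apply: (cell_bias_sum st (h := fun i => ext m i - grid_signal f n i) a f_step alpha_le bn) => i.
by rewrite extE mxE.
Qed.

End observations.

Theorem theorem5 (R : realType) (d : measure_display) (T : measurableType d)
    (P : probability T R) (f : R -> R) (sigma delta : R)
    (xi : forall n, 'I_n -> {RV P >-> R})
    (sigma_hat gamma : nat -> {RV P >-> R})
    (gamma_MR : nat -> T -> \bar R)
    (u_MR u_hat : forall n, 'I_n -> {RV P >-> R})
    (f_step : right_cont_step f)
    (sigma_gt0 : 0 < sigma) (delta_gt0 : 0 < delta)
    (xi_normal : forall n (i : 'I_n), has_normal_law 0 sigma (xi n i))
    (xi_indep : forall n, mutually_independent (xi n))
    (sigma_hat_consistent : cvg_in_probability sigma_hat sigma)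
    (MR_chosen : {ae P, forall w, forall n,
      (exists g u, MR_admissible delta (sigma_hat n w)
                     (observations f (xi n) w) g u) ->
      MR_choice delta (sigma_hat n w) (observations f (xi n) w)
        (gamma_MR n w) (random_vector (u_MR n) w)})
    (gamma_cvg0 : {ae P, forall w, (gamma n w @[n --> \oo]) --> (0 : R)})
    (gamma_rate : {ae P, forall w,
      (gamma n w * n%:R / ln n%:R @[n --> \oo]) --> +oo})
    (u_hat_argmin : {ae P, forall w, forall n,
      argmin_potts (gamma n w)%:E (observations f (xi n) w)
        (random_vector (u_hat n) w)}) :
  P [set w | iota_embed (random_vector (u_MR n) w) =
             iota_embed (random_vector (u_hat n) w)] @[n --> \oo] --> 1%E.
Proof.
have [K [alpha [t [st red]]]] := right_cont_step_reduced f_step.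
have [D [rho [D0 rho0 sgn]]] := grid_step_signal st red.
have [C [C0 hC]] := finite_upper_bound alpha K.+1.
have d1 : 0 < 1 + delta by rewrite addr_gt0.
have sq2 : 0 < Num.sqrt (2 : R) by rewrite sqrtr_gt0.
have sq22 : Num.sqrt (2 : R) ^+ 2 = 2 by rewrite sqr_sqrtr.
have sqK : 0 < Num.sqrt (K.+1%:R : R) by rewrite sqrtr_gt0 ltr0n.
have K1 : 1 <= K.+1%:R :> R by rewrite ler1n.
(* Factors for all intervals, for anchored intervals, and the precision asked
   from the estimate of [sigma]: together they fit into the margin [delta]. *)
pose lam : R := Num.sqrt 2 * (1 + delta / 4).
have lam0 : 0 < lam by rewrite mulr_gt0// addr_gt0// divr_gt0.
have lam2 : 2 < lam ^+ 2.
  rewrite exprMn sq22 -[ltLHS]mulr1 ltr_pM2l// exprn_egt1//; lra.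
pose tau : R := delta / (192 * Num.sqrt K.+1%:R).
have tau0 : 0 < tau by rewrite divr_gt0// mulr_gt0.
pose e : R := sigma * (delta / (2 * (1 + delta))).
have eE : (1 + delta) * e = sigma * delta / 2.
  by rewrite /e; field; rewrite gt_eqF.
have e2 : e <= sigma / 2.
  by rewrite -(ler_pM2l d1) eE; lra.
have e0 : 0 < e by rewrite !mulr_gt0// invr_gt0 mulr_gt0.
pose Cb : R := 2 * C * K%:R.
have Cb0 : 0 <= Cb by rewrite !mulr_ge0.
(* [M] and [eps] delimit the penalties for which minimizers have exactly [K] jumps. *)
pose M : R := 4 * crude_bound sigma lam Cb * K.+1%:R.
have cb0 : 0 <= crude_bound sigma lam Cb by exact: sqr_ge0.
have M0 : 0 <= M by rewrite mulr_ge0// mulr_ge0.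
pose eps : R := rho * D ^+ 2 / (16 * K.+1%:R).
have eps0 : 0 < eps by rewrite divr_gt0 ?mulr_gt0 ?exprn_gt0.
pose c1 : R := 4 * ((1 + delta) * (2 * sigma) * Num.sqrt 2 + sigma * lam + Cb) ^+ 2.
have c10 : 0 <= c1 by rewrite mulr_ge0 ?sqr_ge0.
have E1 := all_noise_whp sigma_gt0 xi_normal xi_indep lam0 lam2.
have E2 := @whp_bigI _ _ _ P K.+1 _ (fun k _ => anchored_noise_whp sigma_gt0 xi_normal
  xi_indep (fun n => mid_cell t n.-1 k) tau0).
have E3 := @whp_bigI _ _ _ P K _ (fun k _ => anchored_noise_whp sigma_gt0 xi_normal
  xi_indep (fun n => jump_cell t n.-1 k) tau0).
have E4 := @no_ties_whp _ _ _ P sigma xi (fun n => @cell_mean R f n)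
  xi_normal xi_indep.
have E5 : whp P (fun n => [set w | `|sigma_hat n w - sigma| <= e]).
  apply: cvg0_whp => [n|].
    apply: measurable_set_le => //; apply: measurableT_comp => //.
    exact: measurable_funB.
  rewrite (_ : (fun n => P (~` _)) = (fun n => P [set w | e < `|sigma_hat n w - sigma|])).
    exact: sigma_hat_consistent.
  apply/funext => n; congr (P _); apply/seteqP; split => w /=.
    by move/negP; rewrite -ltNge.
  by move=> h; apply/negP; rewrite -ltNge.
have E6 : whp P (fun n => [set w | gamma n w <= eps]).
  apply: ae_eventually_whp => [n|]; first exact: measurable_set_le.
  move: gamma_cvg0; apply: filterS => w /cvgrPdist_le /(_ _ eps0).
  apply: filterS => n; rewrite sub0r normrN; apply: le_trans; exact: ler_norm.
have E7 : whp P (fun n => [set w | M < gamma n w * n%:R / ln n%:R]).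
  apply: ae_eventually_whp => [n|].
    apply: measurable_set_lt => //.
    by apply: measurable_funM => //; apply: measurable_funM.
  by move: gamma_rate; apply: filterS => w /cvgryPgt; exact.
have E8 := ae_whp MR_chosen.
have E9 := ae_whp u_hat_argmin.
apply: whp_cvg1.
  by apply: filterS (nbhs_infty_gt 0) => -[//|n] _; exact: measurable_equal_fits.
have large : \forall n \near \oo,
    [/\ (0 < n)%N, 1 <= rho * n%:R & 1 <= ln (n%:R : R)] /\
    [/\ (Cb / (sigma * tau)) ^+ 2 <= ln (n%:R : R),
        ((Cb + 2 * C) / (sigma * delta / 8)) ^+ 2 <= ln (n%:R : R),
        ln (n%:R : R) <= rho * D ^+ 2 / (16 * (M + 1)) * n%:R &
        ln (n%:R : R) <= D ^+ 2 * rho / (c1 + 1) * n%:R].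
  near=> n; split; split; near: n.
  - exact: nbhs_infty_gt.
  - apply: filterS (nbhs_infty_ger rho^-1) => n.
    by rewrite -ler_pdivrMl// mulr1.
  - exact: near_ln_ge.
  - exact: near_ln_ge.
  - exact: near_ln_ge.
  - by apply: near_ln_le; rewrite divr_gt0 ?mulr_gt0 ?exprn_gt0// ltr_wpDl.
  - by apply: near_ln_le; rewrite divr_gt0 ?mulr_gt0 ?exprn_gt0// ltr_wpDl.
apply: whp_sub (whpI E1 (whpI E2 (whpI E3 (whpI E4 (whpI E5 (whpI E6 (whpI E7
  (whpI E8 E9)))))))).
apply: filterS large => -[[[]//]|n] [[_ rhon Lge1] [Lanchor Lconst L1 L2]] w /=.
move=> [w1 [w2 [w3 [w4 [w5 [w6 [w7 [w8 w9]]]]]]]].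
set L := ln _ in L2 L1 Lconst Lanchor Lge1 w7.
have N0 : 0 < n.+1%:R :> R by rewrite ltr0n.
congr iota_embed.
have sg := sgn n rhon.
have sL1 : 1 <= Num.sqrt L by rewrite -[leLHS]sqrtr1 ler_wsqrtr.
have se : sigma - e <= sigma_hat n.+1 w <= sigma + e.
  by move: w5; rewrite ler_distl.
apply: (MR_fit_unique (C := C) (s := sigma_hat n.+1 w) (ns := noise xi n.+1 w)
  (g := gamma n.+1 w) (gMR := gamma_MR n.+1 w)
  (z := fun i => ext (observations f (xi n.+1) w) i - grid_signal f n i)
  sg _ _ Cb0 sigma_gt0 delta_gt0 lam0 tau0 _ _ _ _ Lge1 _ _ _ _ _ _ _ w4).
- by move=> i _; rewrite addrC subrK.
- by move=> i hi; apply: (grid_signal_le st).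
- move=> a b hab; exact: (observations_noise (xi n.+1) f_step st hC).
- by move=> a b hab; exact: w1.
- by move=> k kK b bn qn; exact: (w2 k kK b bn qn).
- by move=> k kK b bn pn; exact: (w3 k kK b bn pn).
- by apply: ge_sqrt_ln => //; exact: mulr_gt0.
- apply: ge_sqrt_ln => //; first by rewrite addr_ge0// mulr_ge0.
  by rewrite divr_gt0// mulr_gt0.
- by rewrite /tau le_eqVlt; apply/orP; left; apply/eqP; field; rewrite gt_eqF.
- have sq21 : 1 <= Num.sqrt (2 : R) by rewrite -[leLHS]sqrtr1 ler_wsqrtr// ler1n.
  have h1 : sigma * delta / 4 * 1 <= sigma * delta / 4 * Num.sqrt 2.
    by apply: ler_wpM2l => //; rewrite divr_ge0// mulr_ge0// ltW.
  have h2 : sigma * (1 + delta / 2) * Num.sqrt 2 <= (1 + delta) * sigma_hat n.+1 w * Num.sqrt 2.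
    apply: ler_wpM2r; first exact: ltW.
    case/andP: se => se _; have := ler_wpM2l (ltW d1) se; lra.
  rewrite /lam; lra.
- by case/andP: se => se _; lra.
- by case/andP: se => _ se; lra.
- rewrite -/c1 -/L; move: L2; rewrite mulrAC ler_pdivlMr ?ltr_wpDl//; lra.
- exact: w9.
- by rewrite -/M -/L [ltRHS]mulrC -ltr_pdivlMr//; exact: lt_le_trans Lge1.
- rewrite -/M -/L.
  have h1 : M * L <= rho * D ^+ 2 / 16 * n.+1%:R.
    move: L1; rewrite invfM mulrA mulrAC ler_pdivlMr ?ltr_wpDl//; lra.
  have h2 : n.+1%:R * gamma n.+1 w * K%:R <= rho * D ^+ 2 / 16 * n.+1%:R.
    apply: (@le_trans _ _ (n.+1%:R * eps * K.+1%:R)); last first.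
      by rewrite le_eqVlt; apply/orP; left; apply/eqP; rewrite /eps; field.
    have g1 : n.+1%:R * gamma n.+1 w <= n.+1%:R * eps by rewrite ler_pM2l.
    apply: (le_trans (ler_wpM2r (ler0n R K) g1)).
    by apply: ler_wpM2l; rewrite ?ler_nat// mulr_ge0// ltW.
  have h3 : 0 < rho * D ^+ 2 * n.+1%:R by rewrite !mulr_gt0// exprn_gt0.
  lra.
- exact: w8.
Unshelve. all: by end_near. Qed.
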